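(* Work in $\mathsf{ZF}$. Let $\kappa$ be a regular cardinal and let $\mathcal{S}$ be a $\kappa$-descending distributive symmetric system. Then $\mathcal{S}$ cannot change the truth value of $\mathsf{EC}_\kappa$; that is, for every $\mathcal{S}$-generic $G$, $V[G]_{\mathcal{S}}\models\mathsf{EC}_\kappa$ if and only if $V\models\mathsf{EC}_\kappa$.
   Context: The base theory is $\mathsf{ZF}$ (no axiom of choice). A notion of forcing is a partial order with a maximum element, assumed throughout to be separative (if $p'\nleq p$ then there is $q\leq p'$ incompatible with $p$); $q\leq p$ means $q$ is stronger; open sets are closed under strengthening. $\mathbb{P}$ is $\kappa$-descending distributive if for every decreasing sequence $\langle D_\alpha\mid\alpha<\kappa\rangle$ of open dense subsets of $\mathbb{P}$, $\bigcap_{\alpha<\kappa}D_\alpha$ is open dense. A symmetric system is $\mathcal{S}=\langle\mathbb{P},\mathscr{G},\mathscr{F}\rangle$ where $\mathbb{P}$ is a notion of forcing, $\mathscr{G}\leq\operatorname{Aut}(\mathbb{P})$ and $\mathscr{F}$ is a normal filter of subgroups of $\mathscr{G}$ (a set of subgroups containing $\mathscr{G}$, closed under supergroups, finite intersections, and conjugation by elements of $\mathscr{G}$). $\mathscr{G}$ acts on $\mathbb{P}$-names by $\pi\dot{x}=\{\langle\pi p,\pi\dot{y}\rangle\mid\langle p,\dot{y}\rangle\in\dot{x}\}$. A $\mathbb{P}$-name $\dot{x}$ is an $\mathcal{S}$-name if $\operatorname{sym}(\dot{x})=\{\pi\in\mathscr{G}\mid\pi\dot{x}=\dot{x}\}\in\mathscr{F}$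 and, for all $\langle p,\dot{y}\rangle\in\dot{x}$, $\dot{y}$ is an $\mathcal{S}$-name. $G$ is $\mathcal{S}$-generic if it is a $V$-generic filter on $\mathbb{P}$, and $V[G]_{\mathcal{S}}=\{\dot{x}^G\mid\dot{x}\text{ an }\mathcal{S}\text{-name}\}$, a model of $\mathsf{ZF}$. $\mathscr{F}$ is $\kappa$-descending distributive if for every sequence $\langle H_\alpha\mid\alpha<\kappa\rangle$ of elements of $\mathscr{F}$ there is an unbounded $I\subseteq\kappa$ with $\bigcap_{\alpha\in I}H_\alpha\in\mathscr{F}$. $\mathcal{S}$ is $\kappa$-descending distributive if both $\mathbb{P}$ and $\mathscr{F}$ are. A selector for a function $F$ is a function $f$ with the same domain such that $f(a)\in F(a)$ for all $a$ in the domain. A function $F$ with domain an ordinal $\alpha$ is $\alpha$-approachable if $F(\beta)\neq\emptyset$ for all $\beta<\alpha$ and $F\upharpoonright\beta$ has a selector for every $\beta<\alpha$. $\mathsf{EC}_\alpha$ is the statement that every $\alpha$-approachable function has a selector. *)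

(* Defs.v *)
From Stdlib Require Import List ClassicalEpsilon FunctionalExtensionality
  PropExtensionality ProofIrrelevance Wellfounded Relation_Operators.

Set Implicit Arguments.
Unset Strict Implicit.
Unset Printing Implicit Defensive.

(** The ambient universe: well-founded trees modulo bisimilarity.  The model [V], the generic filter
    and the symmetric extension all live in this universe, so that membership
    and equality mean the same thing in all of them. *)

Inductive tree : Type := Node (A : Type) (f : A -> tree).
Arguments Node : clear implicits.

Definition branches (t : tree) : Type := let (A, _) := t in A.

Definition branch (t : tree) : branches t -> tree :=
  match t with Node _ f => f end.

Fixpoint bisim (s t : tree) : Prop :=
  match s, t with
  | Node A f, Node B g =>
      (forall a, exists b, bisim (f a) (g b)) /\
      (forall b, exists a, bisim (f a) (g b))
  end.

Lemma bisim_refl t : bisim t t.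
Proof. induction t as [A f IH]; simpl; split; intros a; exists a; apply IH. Qed.

Lemma bisim_sym s t : bisim s t -> bisim t s.
Proof.
revert t; induction s as [A f IH]; intros [B g] [H1 H2]; simpl; split.
- intros b; destruct (H2 b) as [a Ha]; exists a; now apply IH.
- intros a; destruct (H1 a) as [b Hb]; exists b; now apply IH.
Qed.

Lemma bisim_trans s t u : bisim s t -> bisim t u -> bisim s u.
Proof.
revert t u; induction s as [A f IH]; intros [B g] [C h] [H1 H2] [K1 K2]; simpl; split.
- intros a; destruct (H1 a) as [b Hb]; destruct (K1 b) as [c Hc].
  exists c; now apply (IH a _ _ Hb).
- intros c; destruct (K2 c) as [b Hb]; destruct (H2 b) as [a Ha].
  exists a; now apply (IH a _ _ Ha).
Qed.

Definition canon (t : tree) : tree := epsilon (inhabits t) (bisim t).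

Lemma canon_bisim t : bisim t (canon t).
Proof. unfold canon; apply epsilon_spec; exists t; apply bisim_refl. Qed.

Lemma canon_eq s t : bisim s t -> canon s = canon t.
Proof.
intros H; unfold canon.
rewrite (proof_irrelevance _ (inhabits s) (inhabits t)); f_equal.
apply functional_extensionality; intros u; apply propositional_extensionality; split.
- now apply bisim_trans, bisim_sym.
- now apply bisim_trans.
Qed.

Lemma canon_idem t : canon (canon t) = canon t.
Proof. symmetry; apply canon_eq, canon_bisim. Qed.

(** The quotient [tree / bisim], realised by canonical representatives so that
    extensional equality is [=]. *)
Definition zset : Type := {t : tree | canon t = t}.

Definition class_of (t : tree) : zset := exist _ (canon t) (canon_idem t).

Definition idx (x : zset) : Type := branches (proj1_sig x).
Definition elt (x : zset) (i : idx x) : zset := class_of (branch i).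

Declare Scope zset_scope.
Local Open Scope zset_scope.

Definition mem (y x : zset) : Prop := exists i : idx x, elt i = y.
Notation "y ∈ x" := (mem y x) (at level 70) : zset_scope.
Notation "y ∉ x" := (~ mem y x) (at level 70) : zset_scope.

Definition subset (x y : zset) : Prop := forall z, z ∈ x -> z ∈ y.
Notation "x ⊆ y" := (subset x y) (at level 70) : zset_scope.

(** [collect f] is the set [{f a | a : A}]. *)
Definition collect (A : Type) (f : A -> zset) : zset :=
  class_of (Node A (fun a => proj1_sig (f a))).

Lemma class_of_eq s t : class_of s = class_of t <-> bisim s t.
Proof.
split.
- intros H; apply (f_equal (@proj1_sig _ _)) in H; simpl in H.
  apply bisim_trans with (canon s); [apply canon_bisim|].
  rewrite H; apply bisim_sym, canon_bisim.
- intros H; apply eq_sig_hprop; [intros; apply proof_irrelevance|].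
  now apply canon_eq.
Qed.

Lemma class_of_repr (x : zset) : class_of (proj1_sig x) = x.
Proof.
apply eq_sig_hprop; [intros; apply proof_irrelevance|]; exact (proj2_sig x).
Qed.

Lemma mem_class_of (y : zset) (t : tree) :
  y ∈ class_of t <-> exists i : branches t, class_of (branch i) = y.
Proof.
unfold mem, idx, elt; simpl; pose proof (canon_bisim t) as H; revert H.
destruct t as [A f]; destruct (canon (Node A f)) as [B g]; simpl; intros [H1 H2]; split.
- intros [b <-]; destruct (H2 b) as [a Ha]; exists a; now apply class_of_eq.
- intros [a <-]; destruct (H1 a) as [b Hb]; exists b; now apply class_of_eq, bisim_sym.
Qed.

Lemma mem_collect (A : Type) (f : A -> zset) (y : zset) :
  y ∈ collect f <-> exists a, f a = y.
Proof.
unfold collect; rewrite mem_class_of; simpl.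
split; intros [a <-]; exists a; [symmetry|]; apply class_of_repr.
Qed.

Lemma zset_ext (x y : zset) : (forall z, z ∈ x <-> z ∈ y) -> x = y.
Proof.
rewrite <- (class_of_repr x), <- (class_of_repr y).
generalize (proj1_sig x) (proj1_sig y); clear x y; intros s t H.
apply class_of_eq; destruct s as [A f]; destruct t as [B g]; simpl; split.
- intros a; assert (K : class_of (f a) ∈ class_of (Node A f)).
  { apply mem_class_of; now exists a. }
  apply H in K; destruct (proj1 (mem_class_of _ _) K) as [b Hb]; exists b.
  now apply bisim_sym, class_of_eq.
- intros b; assert (K : class_of (g b) ∈ class_of (Node B g)).
  { apply mem_class_of; now exists b. }
  apply H in K; destruct (proj1 (mem_class_of _ _) K) as [a Ha]; exists a.
  now apply class_of_eq.
Qed.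

Lemma mem_wf : well_founded mem.
Proof.
intros x; rewrite <- (class_of_repr x); generalize (proj1_sig x); clear x; intros t.
induction t as [A f IH]; constructor; intros y Hy.
destruct (proj1 (mem_class_of _ _) Hy) as [a <-]; apply IH.
Qed.

Definition empty : zset := collect (fun x : False => match x with end).

Definition upair (a b : zset) : zset := collect (fun c : bool => if c then a else b).

Definition opair (a b : zset) : zset := upair (upair a a) (upair a b).
Notation "⟨ a , b ⟩" := (opair a b) : zset_scope.

Definition bigcup (x : zset) : zset :=
  collect (fun i : {i : idx x & idx (elt i)} => elt (projT2 i)).
Notation "⋃ x" := (bigcup x) (at level 35, right associativity) : zset_scope.

Definition sep (x : zset) (Q : zset -> Prop) : zset :=
  collect (fun i : {i : idx x | Q (elt i)} => elt (proj1_sig i)).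

Definition image (f : zset -> zset) (x : zset) : zset :=
  collect (fun i : idx x => f (elt i)).

Definition inter (x y : zset) : zset := sep x (fun z => z ∈ y).

Definition succ (x : zset) : zset := ⋃ upair x (upair x x).

Definition omega : zset := collect (fun n : nat => Nat.iter n succ empty).

Lemma mem_idx (x : zset) (i : idx x) : elt i ∈ x.
Proof. now exists i. Qed.

Lemma mem_upair a b z : z ∈ upair a b <-> z = a \/ z = b.
Proof.
unfold upair; rewrite mem_collect; split.
- intros [[|] <-]; auto.
- intros [-> | ->]; [now exists true | now exists false].
Qed.

Lemma mem_bigcup x z : z ∈ ⋃ x <-> exists y, y ∈ x /\ z ∈ y.
Proof.
unfold bigcup; rewrite mem_collect; split.
- intros [[i j] <-]; exists (elt i); split; apply mem_idx.
- intros [y [[i <-] [j <-]]]; now exists (existT _ i j).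
Qed.

Lemma mem_sep x Q z : z ∈ sep x Q <-> z ∈ x /\ Q z.
Proof.
unfold sep; rewrite mem_collect; split.
- intros [[i Hi] <-]; split; [apply mem_idx | exact Hi].
- intros [[i <-] Hi]; now exists (exist _ i Hi).
Qed.

Lemma mem_image f x z : z ∈ image f x <-> exists y, y ∈ x /\ f y = z.
Proof.
unfold image; rewrite mem_collect; split.
- intros [i <-]; exists (elt i); split; [apply mem_idx | reflexivity].
- intros [y [[i <-] <-]]; now exists i.
Qed.

Lemma opair_inj a b c d : ⟨a, b⟩ = ⟨c, d⟩ -> a = c /\ b = d.
Proof.
intros H.
assert (H1 : forall z, z ∈ ⟨a, b⟩ <-> z ∈ ⟨c, d⟩) by (rewrite H; tauto).
unfold opair in H1.
assert (U : forall x y u v, upair x y = upair u v ->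
  (x = u /\ y = v) \/ (x = v /\ y = u)).
{ intros x y u v E.
  assert (K : forall z, z ∈ upair x y <-> z ∈ upair u v) by (rewrite E; tauto).
  pose proof (K x) as Kx; pose proof (K y) as Ky; pose proof (K u) as Ku;
  pose proof (K v) as Kv; rewrite !mem_upair in Kx, Ky, Ku, Kv.
  clear - Kx Ky Ku Kv.
  destruct (proj1 Kx (or_introl eq_refl)); destruct (proj1 Ky (or_intror eq_refl));
  destruct (proj2 Ku (or_introl eq_refl)); destruct (proj2 Kv (or_intror eq_refl));
  subst; auto. }
apply U in H; destruct H as [[E1 E2] | [E1 E2]];
apply U in E1; apply U in E2;
destruct E1 as [[? ?] | [? ?]]; destruct E2 as [[? ?] | [? ?]]; subst; auto.
Qed.

(** The notions below that do not mention a class [M] are absolute between the universe and transitive models. *)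

Definition isfun (f : zset) : Prop :=
  (forall w, w ∈ f -> exists x y, w = ⟨x, y⟩) /\
  (forall x y y', ⟨x, y⟩ ∈ f -> ⟨x, y'⟩ ∈ f -> y = y').

Definition fdom (f : zset) : zset := sep (⋃ ⋃ f) (fun x => exists y, ⟨x, y⟩ ∈ f).

(** For a function [f] and [x] in its domain, the union of the singleton [{f(x)}]. *)
Definition app (f x : zset) : zset := ⋃ sep (⋃ ⋃ f) (fun y => ⟨x, y⟩ ∈ f).

Definition restr (f d : zset) : zset :=
  sep f (fun w => exists x y, x ∈ d /\ w = ⟨x, y⟩).

Definition maps (f a b : zset) : Prop :=
  isfun f /\ fdom f = a /\ forall x, x ∈ a -> app f x ∈ b.

Definition bijection (f a b : zset) : Prop :=
  maps f a b /\
  (forall x x', x ∈ a -> x' ∈ a -> app f x = app f x' -> x = x') /\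
  (forall y, y ∈ b -> exists x, x ∈ a /\ app f x = y).

Definition idfun (a : zset) : zset := image (fun x => ⟨x, x⟩) a.
Definition comp (g f : zset) : zset := image (fun x => ⟨x, app g (app f x)⟩) (fdom f).
Definition invfun (f : zset) : zset := image (fun x => ⟨app f x, x⟩) (fdom f).

Lemma mem_fdom f x : x ∈ fdom f <-> exists y, ⟨x, y⟩ ∈ f.
Proof.
unfold fdom; rewrite mem_sep; split; [now intros []|].
intros [y Hy]; split; [|now exists y].
apply mem_bigcup; exists (upair x y); split; [|apply mem_upair; auto].
apply mem_bigcup; exists ⟨x, y⟩; split; [exact Hy | apply mem_upair; auto].
Qed.

Lemma app_eq f x y : isfun f -> ⟨x, y⟩ ∈ f -> app f x = y.
Proof.
intros [_ Hf] Hxy; apply zset_ext; intros z; unfold app; rewrite mem_bigcup; split.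
- intros [y' [Hy' Hz]]; apply mem_sep in Hy'; destruct Hy' as [_ Hy'].
  now rewrite (Hf _ _ _ Hxy Hy').
- intros Hz; exists y; split; [|exact Hz]; apply mem_sep; split; [|exact Hxy].
  apply mem_bigcup; exists (upair x y); split; [|apply mem_upair; auto].
  apply mem_bigcup; exists ⟨x, y⟩; split; [exact Hxy | apply mem_upair; auto].
Qed.

Definition transitive_set (x : zset) : Prop := forall y, y ∈ x -> y ⊆ x.

Definition ordinal (a : zset) : Prop :=
  transitive_set a /\ forall b, b ∈ a -> transitive_set b.

Definition unbounded (A a : zset) : Prop :=
  A ⊆ a /\ forall b, b ∈ a -> exists c, c ∈ A /\ (b ∈ c \/ b = c).

(** A model is a transitive class [M], with the true membership relation.
    Formulas use de Bruijn indices. *)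

Inductive form : Type :=
| fEq (i j : nat)
| fMem (i j : nat)
| fBot
| fImp (A B : form)
| fAll (A : form).

Fixpoint sat (M : zset -> Prop) (e : list zset) (A : form) : Prop :=
  match A with
  | fEq i j => nth i e empty = nth j e empty
  | fMem i j => nth i e empty ∈ nth j e empty
  | fBot => False
  | fImp A B => sat M e A -> sat M e B
  | fAll A => forall x, M x -> sat M (x :: e) A
  end.

(** Unassigned variables of a formula denote [empty], which belongs to every
    transitive model. *)
Record ZF_model (M : zset -> Prop) : Prop := {
  ZF_transitive : forall x y, M x -> y ∈ x -> M y;
  ZF_ext : forall x y, M x -> M y ->
    (forall z, M z -> (z ∈ x <-> z ∈ y)) -> x = y;
  ZF_found : forall x, M x -> (exists y, M y /\ y ∈ x) ->
    exists y, M y /\ y ∈ x /\ forall z, M z -> z ∈ y -> z ∉ x;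
  ZF_pair : forall a b, M a -> M b ->
    exists c, M c /\ forall z, M z -> (z ∈ c <-> z = a \/ z = b);
  ZF_union : forall x, M x ->
    exists u, M u /\ forall z, M z -> (z ∈ u <-> exists y, M y /\ y ∈ x /\ z ∈ y);
  ZF_power : forall x, M x ->
    exists p, M p /\ forall z, M z -> (z ∈ p <-> forall w, M w -> w ∈ z -> w ∈ x);
  ZF_inf : exists w, M w /\
    (exists e, M e /\ e ∈ w /\ forall z, M z -> z ∉ e) /\
    (forall x, M x -> x ∈ w ->
      exists s, M s /\ s ∈ w /\ forall z, M z -> (z ∈ s <-> z ∈ x \/ z = x));
  ZF_sep : forall (A : form) (e : list zset) (a : zset), Forall M e -> M a ->
    exists b, M b /\ forall x, M x -> (x ∈ b <-> x ∈ a /\ sat M (x :: e) A);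
  ZF_repl : forall (A : form) (e : list zset) (a : zset), Forall M e -> M a ->
    (forall x, M x -> x ∈ a -> exists! y, M y /\ sat M (x :: y :: e) A) ->
    exists b, M b /\ forall y, M y ->
      (y ∈ b <-> exists x, M x /\ x ∈ a /\ sat M (x :: y :: e) A)
}.

Definition regular_cardinal (M : zset -> Prop) (k : zset) : Prop :=
  ordinal k /\ omega ⊆ k /\
  (forall a f, a ∈ k -> M f -> ~ bijection f a k) /\
  (forall a f, a ∈ k -> M f -> maps f a k -> ~ unbounded (image (app f) a) k).

Definition selector (f F : zset) : Prop :=
  isfun f /\ fdom f = fdom F /\ forall a, a ∈ fdom F -> app f a ∈ app F a.

Definition approachable (M : zset -> Prop) (a F : zset) : Prop :=
  isfun F /\ fdom F = a /\
  (forall b, b ∈ a -> app F b <> empty) /\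
  (forall b, b ∈ a -> exists f, M f /\ selector f (restr F b)).

(** [EC M a] is the relativization of EC to [M], i.e. satisfaction in [M]. *)
Definition EC (M : zset -> Prop) (a : zset) : Prop :=
  forall F, M F -> approachable M a F -> exists f, M f /\ selector f F.

(** [⟨q, p⟩ ∈ L] means that [q] is stronger than (or equal to) [p]. *)
Section Forcing.
Variables (P L : zset).

Definition compatible (p q : zset) : Prop :=
  exists r, r ∈ P /\ ⟨r, p⟩ ∈ L /\ ⟨r, q⟩ ∈ L.

Record forcing_notion : Prop := {
  forcing_rel : forall w, w ∈ L -> exists q p, q ∈ P /\ p ∈ P /\ w = ⟨q, p⟩;
  forcing_refl : forall p, p ∈ P -> ⟨p, p⟩ ∈ L;
  forcing_trans : forall p q r, ⟨r, q⟩ ∈ L -> ⟨q, p⟩ ∈ L -> ⟨r, p⟩ ∈ L;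
  forcing_antisym : forall p q, ⟨q, p⟩ ∈ L -> ⟨p, q⟩ ∈ L -> p = q;
  forcing_max : exists m, m ∈ P /\ forall p, p ∈ P -> ⟨p, m⟩ ∈ L;
  forcing_separative : forall p p', p ∈ P -> p' ∈ P -> ~ ⟨p', p⟩ ∈ L ->
    exists q, q ∈ P /\ ⟨q, p'⟩ ∈ L /\ ~ compatible q p
}.

Definition dense (D : zset) : Prop :=
  D ⊆ P /\ forall p, p ∈ P -> exists q, q ∈ D /\ ⟨q, p⟩ ∈ L.

Definition open_dense (D : zset) : Prop :=
  dense D /\ forall p q, p ∈ D -> ⟨q, p⟩ ∈ L -> q ∈ D.

Definition automorphism (f : zset) : Prop :=
  bijection f P P /\
  forall p q, p ∈ P -> q ∈ P -> (⟨q, p⟩ ∈ L <-> ⟨app f q, app f p⟩ ∈ L).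

Definition automorphism_group (H : zset) : Prop :=
  (forall f, f ∈ H -> automorphism f) /\
  idfun P ∈ H /\
  (forall f g, f ∈ H -> g ∈ H -> comp f g ∈ H) /\
  (forall f, f ∈ H -> invfun f ∈ H).

End Forcing.

Record system : Type := System {
  cond : zset;
  ord : zset;
  grp : zset;
  filt : zset
}.

Definition conjugate (f H : zset) : zset :=
  image (fun g => comp f (comp g (invfun f))) H.

Definition subgroup_of (S : system) (H : zset) : Prop :=
  H ⊆ grp S /\ automorphism_group (cond S) (ord S) H.

Record symmetric_system (M : zset -> Prop) (S : system) : Prop := {
  sys_cond : M (cond S);
  sys_ord : M (ord S);
  sys_grp : M (grp S);
  sys_filt : M (filt S);
  sys_forcing : forcing_notion (cond S) (ord S);
  sys_group : automorphism_group (cond S) (ord S) (grp S);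
  sys_subgroup : forall H, H ∈ filt S -> subgroup_of S H;
  sys_top : grp S ∈ filt S;
  sys_up : forall H K, M K -> H ∈ filt S -> subgroup_of S K -> H ⊆ K -> K ∈ filt S;
  sys_inter : forall H K, H ∈ filt S -> K ∈ filt S -> inter H K ∈ filt S;
  sys_normal : forall f H, f ∈ grp S -> H ∈ filt S -> conjugate f H ∈ filt S
}.

Definition forcing_desc_distributive (M : zset -> Prop) (k : zset) (S : system) : Prop :=
  forall D, M D -> isfun D -> fdom D = k ->
    (forall a, a ∈ k -> open_dense (cond S) (ord S) (app D a)) ->
    (forall a b, b ∈ k -> a ∈ b -> app D b ⊆ app D a) ->
    open_dense (cond S) (ord S)
      (sep (cond S) (fun p => forall a, a ∈ k -> p ∈ app D a)).

Definition filter_desc_distributive (M : zset -> Prop) (k : zset) (S : system) : Prop :=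
  forall H, M H -> maps H k (filt S) ->
    exists I, M I /\ unbounded I k /\
      sep (grp S) (fun f => forall a, a ∈ I -> f ∈ app H a) ∈ filt S.

Definition desc_distributive (M : zset -> Prop) (k : zset) (S : system) : Prop :=
  forcing_desc_distributive M k S /\ filter_desc_distributive M k S.

Definition subname (y x : zset) : Prop := exists p, ⟨p, y⟩ ∈ x.

Lemma mem_field p y x : ⟨p, y⟩ ∈ x -> p ∈ ⋃ ⋃ x /\ y ∈ ⋃ ⋃ x.
Proof.
intros H; split; apply mem_bigcup; exists (upair p y);
(split; [apply mem_bigcup; exists ⟨p, y⟩; split;
  [exact H | apply mem_upair; auto] | apply mem_upair; auto]).
Qed.

Lemma subname_wf : well_founded subname.
Proof.
assert (Hwf : well_founded (clos_trans zset mem)) by apply wf_clos_trans, mem_wf.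
intros x; induction (Hwf x) as [x _ IH]; constructor; intros y [p Hp]; apply IH.
apply t_trans with ⟨p, y⟩; [|now apply t_step].
apply t_trans with (upair p y);
  apply t_step; unfold opair; apply mem_upair; auto.
Qed.

(** The ordered pairs belonging to [x]. *)
Definition entry (x : zset) : Type :=
  {i : idx (⋃ ⋃ x) * idx (⋃ ⋃ x) | ⟨elt (fst i), elt (snd i)⟩ ∈ x}.

Definition entry_cond (x : zset) (i : entry x) : zset := elt (fst (proj1_sig i)).
Definition entry_name (x : zset) (i : entry x) : zset := elt (snd (proj1_sig i)).

Lemma entry_subname (x : zset) (i : entry x) : subname (entry_name i) x.
Proof. exists (entry_cond i); exact (proj2_sig i). Qed.

Lemma entryP (x p y : zset) :
  ⟨p, y⟩ ∈ x <-> exists i : entry x, entry_cond i = p /\ entry_name i = y.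
Proof.
split.
- intros H; destruct (mem_field H) as [[i Hi] [j Hj]]; subst.
  now exists (exist _ (i, j) H).
- intros [i [<- <-]]; exact (proj2_sig i).
Qed.

(** The action of [f] on names: see [mem_act]. *)
Definition act (f : zset) : zset -> zset :=
  Fix subname_wf (fun _ => zset) (fun x rec =>
    collect (fun i : entry x => ⟨app f (entry_cond i), rec (entry_name i) (entry_subname i)⟩)).

(** The interpretation of names by [G]: see [mem_val]. *)
Definition val (G : zset) : zset -> zset :=
  Fix subname_wf (fun _ => zset) (fun x rec =>
    collect (fun i : {i : entry x | entry_cond i ∈ G} =>
      rec (entry_name (proj1_sig i)) (entry_subname (proj1_sig i)))).

Lemma mem_act f x z :
  z ∈ act f x <-> exists p y, ⟨p, y⟩ ∈ x /\ z = ⟨app f p, act f y⟩.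
Proof.
unfold act; rewrite Fix_eq.
- fold (act f); rewrite mem_collect; split.
  + intros [i <-]; exists (entry_cond i), (entry_name i); split; [|reflexivity].
    apply entryP; now exists i.
  + intros [p [y [H ->]]]; apply entryP in H; destruct H as [i [<- <-]]; now exists i.
- intros x' g h Hgh; f_equal; apply functional_extensionality; intros i; now rewrite Hgh.
Qed.

Lemma mem_val G x z :
  z ∈ val G x <-> exists p y, p ∈ G /\ ⟨p, y⟩ ∈ x /\ z = val G y.
Proof.
unfold val; rewrite Fix_eq.
- fold (val G); rewrite mem_collect; split.
  + intros [[i Hi] <-]; exists (entry_cond i), (entry_name i).
    split; [exact Hi|split; [|reflexivity]]; apply entryP; now exists i.
  + intros [p [y [Hp [H ->]]]]; apply entryP in H; destruct H as [i [<- <-]].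
    now exists (exist _ i Hp).
- intros x' g h Hgh; f_equal; apply functional_extensionality; intros i; now rewrite Hgh.
Qed.

Inductive is_name (P : zset) : zset -> Prop :=
| Is_name x :
    (forall w, w ∈ x -> exists p y, w = ⟨p, y⟩ /\ p ∈ P /\ is_name P y) ->
    is_name P x.

Definition sym (S : system) (x : zset) : zset :=
  sep (grp S) (fun f => act f x = x).

Inductive symmetric_name (M : zset -> Prop) (S : system) : zset -> Prop :=
| Symmetric_name x :
    M x -> is_name (cond S) x -> sym S x ∈ filt S ->
    (forall p y, ⟨p, y⟩ ∈ x -> symmetric_name M S y) ->
    symmetric_name M S x.

Record generic (M : zset -> Prop) (S : system) (G : zset) : Prop := {
  generic_sub : G ⊆ cond S;
  generic_nonempty : exists p, p ∈ G;
  generic_up : forall p q, q ∈ G -> ⟨q, p⟩ ∈ ord S -> p ∈ G;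
  generic_dir : forall p q, p ∈ G -> q ∈ G ->
    exists r, r ∈ G /\ ⟨r, p⟩ ∈ ord S /\ ⟨r, q⟩ ∈ ord S;
  generic_meets : forall D, M D -> dense (cond S) (ord S) D ->
    exists p, p ∈ D /\ p ∈ G
}.

Definition extension (M : zset -> Prop) (S : system) (G : zset) : zset -> Prop :=
  fun z => exists x, symmetric_name M S x /\ z = val G x.

(* Main.v *)
From Stdlib Require Import List PeanoNat Lia Classical ClassicalEpsilon
  FunctionalExtensionality Wellfounded Relation_Operators.
Require Import Defs.

Set Implicit Arguments.
Unset Strict Implicit.
Unset Printing Implicit Defensive.

Local Open Scope zset_scope.

(** Neither direction can rely on initial segments of new sequences lying in the
    ground model: for uncountable [k], descending distributivity is compatible with
    adding, say, a Cohen real.  It yields one thing only ([distributive_meet]): if a decreasing sequence of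
    open sets of length [k] lies in [V] and the generic filter [G] meets each of the
    sets, then a single condition of [G] belongs to all of them.  The second common
    ingredient is that an unbounded set of places is as good as [k]: selectors of
    [F ↾ c] for the [c] in an unbounded [I] glue to a selector of [F], by using at [b]
    the least [c] in [I] above [b] ([selector_glue]).

    From the extension to [V] ([EC_ground]).  Let [F] be approachable in [V], and send
    [a] to the set of selectors of [F ↾ a].  Restriction of selectors makes this
    sequence approachable in [V], hence in the extension, where it has a selector [g].
    Being the condition that decides [g] at some place beyond [a] is an open property
    that decreases with [a], so some condition of [G] decides [g] at unboundedly many
    places, and [V] can glue the selectors found there.

    From [V] to the extension ([EC_lift_selector]).  Let [F] be approachable in the
    extension.  Forcing some symmetric name to be a selector of [F ↾ a] is open and
    decreases with [a], so some [q] in [G] does this for all [a] in [k].  In [V], the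
    sets of symmetric names that [q] forces to be selectors of [F ↾ a] form an
    approachable sequence, because names of functions can be restricted uniformly.
    A selector [c] of it is a sequence of symmetric names that need not be symmetric
    as a sequence.  Distributivity of the filter gives an unbounded [I] such that one
    group in the filter fixes [c a] for all [a] in [I], and gluing along [I] produces a
    symmetric name.

    The forcing theorem is needed for equality and membership of names only
    ([feq_sound], [feq_complete], [fmem_truth]).  Forced equality is the existence of a
    set of [V] that is a bisimulation relative to the conditions, so that its
    definability is immediate and no recursion on pairs of names is involved.  What must
    be shown to lie in [V] is obtained from a calculus of definable relations and
    operations ([definable], [definable_term]), including definitions by recursion
    ([definable_recursion]), which covers the action on names and the canonical names
    of sets. *)

(** * Sets in the ambient universe *)

Definition union2 (x y : zset) : zset := ⋃ upair x y.

Lemma mem_union2 x y z : z ∈ union2 x y <-> z ∈ x \/ z ∈ y.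
Proof.
unfold union2; rewrite mem_bigcup; split.
- intros [w [Hw Hz]]; apply mem_upair in Hw; destruct Hw; subst; auto.
- intros [H | H]; [exists x | exists y]; rewrite mem_upair; auto.
Qed.

Lemma not_mem_empty z : z ∉ empty.
Proof. intros H; destruct (proj1 (mem_collect _ _) H) as [[] _]. Qed.

Lemma mem_inter x y z : z ∈ inter x y <-> z ∈ x /\ z ∈ y.
Proof. exact (mem_sep x (fun z => z ∈ y) z). Qed.

Lemma mem_succ x z : z ∈ succ x <-> z ∈ x \/ z = x.
Proof.
change (succ x) with (union2 x (upair x x)); rewrite mem_union2, mem_upair; tauto.
Qed.

Lemma nonempty_inhabited x : x <> empty -> exists z, z ∈ x.
Proof.
intros H; apply NNPP; intros K; apply H, zset_ext; intros z; split; intros Hz.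
- destruct K; now exists z.
- destruct (not_mem_empty Hz).
Qed.

Lemma pair_components_bigcup a b : a ∈ ⋃ ⟨a, b⟩ /\ b ∈ ⋃ ⟨a, b⟩.
Proof.
split; apply mem_bigcup; exists (upair a b); unfold opair; rewrite !mem_upair; auto.
Qed.

(** The projections are total, and written with bounded quantifiers so that
    they are visibly definable. *)
Definition zfst (w : zset) : zset :=
  ⋃ sep (⋃ w) (fun x => exists y, y ∈ ⋃ w /\ w = ⟨x, y⟩).
Definition zsnd (w : zset) : zset :=
  ⋃ sep (⋃ w) (fun y => exists x, x ∈ ⋃ w /\ w = ⟨x, y⟩).

Lemma bigcup_unique (s x : zset) : (forall y, y ∈ s <-> y = x) -> ⋃ s = x.
Proof.
intros H; apply zset_ext; intros z; rewrite mem_bigcup; split.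
- intros [y [Hy Hz]]; apply H in Hy; now subst.
- intros Hz; exists x; now rewrite H.
Qed.

Lemma zfst_pair a b : zfst ⟨a, b⟩ = a.
Proof.
apply bigcup_unique; intros y; rewrite mem_sep; split.
- intros [_ [z [_ E]]]; now destruct (opair_inj E).
- intros ->; split; [apply pair_components_bigcup|].
  exists b; split; [apply pair_components_bigcup | reflexivity].
Qed.

Lemma zsnd_pair a b : zsnd ⟨a, b⟩ = b.
Proof.
apply bigcup_unique; intros y; rewrite mem_sep; split.
- intros [_ [z [_ E]]]; now destruct (opair_inj E).
- intros ->; split; [apply pair_components_bigcup|].
  exists a; split; [apply pair_components_bigcup | reflexivity].
Qed.

Definition pairs (x : zset) : zset :=
  sep x (fun w => exists a, a ∈ ⋃ w /\ exists b, b ∈ ⋃ w /\ w = ⟨a, b⟩).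

Lemma mem_pairs x w : w ∈ pairs x <-> w ∈ x /\ exists a b, w = ⟨a, b⟩.
Proof.
unfold pairs; rewrite mem_sep; split.
- intros [H [a [_ [b [_ E]]]]]; eauto.
- intros [H [a [b ->]]]; split; [exact H|].
  exists a; split; [apply pair_components_bigcup|].
  exists b; split; [apply pair_components_bigcup | reflexivity].
Qed.

Definition prod (a b : zset) : zset :=
  ⋃ image (fun x => image (fun y => ⟨x, y⟩) b) a.

Lemma mem_prod a b w : w ∈ prod a b <-> exists x y, x ∈ a /\ y ∈ b /\ w = ⟨x, y⟩.
Proof.
unfold prod; rewrite mem_bigcup; split.
- intros [z [Hz Hw]]; apply mem_image in Hz; destruct Hz as [x [Hx <-]].
  apply mem_image in Hw; destruct Hw as [y [Hy <-]]; eauto.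
- intros [x [y [Hx [Hy ->]]]]; exists (image (fun y => ⟨x, y⟩) b).
  rewrite !mem_image; split; eauto.
Qed.

Lemma mem_prod_pair a b x y : ⟨x, y⟩ ∈ prod a b <-> x ∈ a /\ y ∈ b.
Proof.
rewrite mem_prod; split; [|intros [Hx Hy]; exists x, y; auto].
intros [x' [y' [Hx [Hy E]]]]; destruct (opair_inj E); now subst.
Qed.

Definition graph (f : zset -> zset) (a : zset) : zset := image (fun x => ⟨x, f x⟩) a.

Lemma mem_graph f a x y : ⟨x, y⟩ ∈ graph f a <-> x ∈ a /\ y = f x.
Proof.
unfold graph; rewrite mem_image; split.
- intros [z [Hz E]]; destruct (opair_inj E); now subst.
- intros [Hx ->]; eauto.
Qed.

Lemma isfun_graph f a : isfun (graph f a).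
Proof.
split.
- intros w Hw; apply mem_image in Hw; destruct Hw as [z [_ <-]]; eauto.
- intros x y y' H K; apply mem_graph in H; apply mem_graph in K.
  destruct H, K; now subst.
Qed.

Lemma fdom_graph f a : fdom (graph f a) = a.
Proof.
apply zset_ext; intros x; rewrite mem_fdom; split.
- intros [y H]; apply mem_graph in H; tauto.
- intros Hx; exists (f x); now apply mem_graph.
Qed.

Lemma app_graph f a x : x ∈ a -> app (graph f a) x = f x.
Proof. intros Hx; apply app_eq; [apply isfun_graph | now apply mem_graph]. Qed.

Lemma app_mem f x : isfun f -> x ∈ fdom f -> ⟨x, app f x⟩ ∈ f.
Proof.
intros Hf Hx; apply mem_fdom in Hx; destruct Hx as [y Hy].
now rewrite (app_eq Hf Hy).
Qed.

Lemma app_iff f x y : isfun f -> x ∈ fdom f -> (⟨x, y⟩ ∈ f <-> y = app f x).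
Proof.
intros Hf Hx; split.
- intros H; symmetry; now apply app_eq.
- intros ->; now apply app_mem.
Qed.

Lemma restr_eq F b : isfun F -> b ⊆ fdom F -> restr F b = graph (app F) b.
Proof.
intros HF Hb; apply zset_ext; intros w; unfold restr; rewrite mem_sep; split.
- intros [Hw [x [y [Hx ->]]]]; apply mem_graph; split; [exact Hx|].
  apply app_iff; auto.
- intros Hw; apply mem_image in Hw; destruct Hw as [x [Hx <-]]; split.
  + apply app_mem; auto.
  + eauto.
Qed.

Lemma selector_restr f F b : isfun F -> b ⊆ fdom F ->
  selector f (restr F b) <->
  isfun f /\ fdom f = b /\ forall a, a ∈ b -> app f a ∈ app F a.
Proof.
intros HF Hb; rewrite (restr_eq HF Hb); unfold selector; rewrite fdom_graph.
split; intros [H1 [H2 H3]]; repeat split; try apply H1; auto.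
- intros a Ha; rewrite <- (app_graph (app F) Ha); auto.
- intros a Ha; rewrite (app_graph (app F) Ha); auto.
Qed.

Definition tmem : zset -> zset -> Prop := clos_trans zset mem.

Lemma tmem_wf : well_founded tmem.
Proof. apply wf_clos_trans, mem_wf. Qed.

Lemma tmem_inv z x : tmem z x <-> z ∈ x \/ exists y, y ∈ x /\ tmem z y.
Proof.
split.
- intros H; induction H as [z x H | z y x H _ H' IH]; [now left|].
  right; destruct IH as [IH | [w [Hw Hy]]]; [now exists y|].
  exists w; split; [exact Hw | now apply t_trans with y].
- intros [H | [y [Hy H]]]; [now apply t_step|].
  apply t_trans with y; [exact H | now apply t_step].
Qed.

Lemma transitive_set_tmem T y z : transitive_set T -> y ∈ T -> tmem z y -> z ∈ T.
Proof.
intros HT Hy H; revert Hy; induction H as [z y H | z w y _ IH1 _ IH2]; intros Hy.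
- exact (HT y Hy z H).
- auto.
Qed.

Lemma subname_tmem y x : subname y x -> tmem y x.
Proof.
intros [p H]; apply t_trans with ⟨p, y⟩; [|now apply t_step].
apply t_trans with (upair p y); apply t_step; unfold opair; apply mem_upair; auto.
Qed.

(** Chosen by its elements, which avoids a recursion with proof arguments; that such
    a set exists is part of [mem_tcl]. *)
Definition tcl (x : zset) : zset :=
  epsilon (inhabits empty) (fun t => forall z, z ∈ t <-> tmem z x).

Lemma mem_tcl x z : z ∈ tcl x <-> tmem z x.
Proof.
revert z; induction (mem_wf x) as [x _ IH].
unfold tcl; apply (epsilon_spec (inhabits empty) (fun t => forall z, z ∈ t <-> tmem z x)).
exists (union2 x (⋃ image tcl x)); intros z.
rewrite mem_union2, tmem_inv, mem_bigcup; apply or_iff_compat_l; split.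
- intros [t [Ht Hz]]; apply mem_image in Ht; destruct Ht as [y [Hy <-]].
  exists y; split; [exact Hy | now apply IH].
- intros [y [Hy Hz]]; exists (tcl y); rewrite mem_image; split; [eauto|].
  now apply IH.
Qed.

Lemma tcl_transitive x : transitive_set (tcl x).
Proof.
intros y Hy z Hz; apply mem_tcl; apply mem_tcl in Hy.
apply t_trans with y; [now apply t_step | exact Hy].
Qed.

Lemma tcl_eq x : tcl x = union2 x (⋃ image tcl x).
Proof.
apply zset_ext; intros z; rewrite mem_tcl, mem_union2, tmem_inv, mem_bigcup.
apply or_iff_compat_l; split.
- intros [y [Hy Hz]]; exists (tcl y); rewrite mem_image, mem_tcl; eauto.
- intros [t [Ht Hz]]; apply mem_image in Ht; destruct Ht as [y [Hy <-]].
  exists y; split; [exact Hy | now apply mem_tcl].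
Qed.

Lemma ordinal_elt a b : ordinal a -> b ∈ a -> ordinal b.
Proof.
intros [Ha Ha'] Hb; split; [now apply Ha'|].
intros c Hc; apply Ha'; now apply (Ha b).
Qed.

Lemma ordinal_trichotomy a b : ordinal a -> ordinal b -> a ∈ b \/ a = b \/ b ∈ a.
Proof.
revert b; induction (mem_wf a) as [a _ IHa]; intros b.
induction (mem_wf b) as [b _ IHb]; intros Ha Hb.
destruct (classic (a ∈ b)) as [|Nab]; [now left|].
destruct (classic (b ∈ a)) as [|Nba]; [now right; right|].
right; left; apply zset_ext; intros c; split; intros Hc.
- destruct (IHa c Hc b (ordinal_elt Ha Hc) Hb) as [H | [-> | H]];
    [exact H | contradiction|].
  destruct Nba; now apply (proj1 Ha c).
- destruct (IHb c Hc Ha (ordinal_elt Hb Hc)) as [H | [-> | H]];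
    [|contradiction|exact H].
  destruct Nab; now apply (proj1 Hb c).
Qed.

Lemma tmem_irrefl x : ~ tmem x x.
Proof. induction (tmem_wf x) as [x _ IH]; intros H; exact (IH x H H). Qed.

Definition next_in (I b c : zset) : Prop :=
  c ∈ I /\ b ∈ c /\ forall d, d ∈ I -> b ∈ d -> c = d \/ c ∈ d.

Lemma next_in_unique I b c d : next_in I b c -> next_in I b d -> c = d.
Proof.
intros [Hc [Hbc Mc]] [Hd [Hbd Md]].
destruct (Mc d Hd Hbd) as [|H]; [assumption|].
destruct (Md c Hc Hbc) as [|H']; [now symmetry|].
exfalso; apply (@tmem_irrefl c); apply t_trans with d; now apply t_step.
Qed.

Lemma next_in_exists k I b : ordinal k -> I ⊆ k -> (exists c, c ∈ I /\ b ∈ c) ->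
  exists c, next_in I b c.
Proof.
intros Hk HI [c [Hc Hb]]; revert Hc Hb; induction (mem_wf c) as [c _ IH]; intros Hc Hb.
destruct (classic (exists d, d ∈ c /\ d ∈ I /\ b ∈ d)) as [[d [Hdc [Hd Hbd]]]|N].
- now apply (IH d).
- exists c; repeat split; auto; intros d Hd Hbd.
  destruct (ordinal_trichotomy (ordinal_elt Hk (HI d Hd)) (ordinal_elt Hk (HI c Hc)))
    as [H | [-> | H]]; auto.
  destruct N; eauto.
Qed.

(** * Definable relations and operations of a model *)

Fixpoint rename (r : nat -> nat) (A : form) : form :=
  match A with
  | fEq i j => fEq (r i) (r j)
  | fMem i j => fMem (r i) (r j)
  | fBot => fBot
  | fImp A B => fImp (rename r A) (rename r B)
  | fAll A => fAll (rename (fun i => match i with 0 => 0 | S i => S (r i) end) A)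
  end.

(** The environments need to agree only on lookups, so one of them may be longer:
    lookups beyond the end give [empty] in both. *)
Lemma sat_rename V A r e e' :
  (forall i, nth i e' empty = nth (r i) e empty) ->
  sat V e (rename r A) <-> sat V e' A.
Proof.
revert r e e'; induction A as [i j|i j| |A IHA B IHB|A IH]; simpl; intros r e e' H.
- now rewrite !H.
- now rewrite !H.
- tauto.
- now rewrite (IHA r e e' H), (IHB r e e' H).
- split; intros K x Hx; specialize (K x Hx); revert K;
    apply IH; intros [|i]; simpl; auto.
Qed.

Section Model.
Variable V : zset -> Prop.

Definition env (n : nat) (e : list zset) : Prop := length e = n /\ Forall V e.

(** Relations are predicates of a list of arguments, the most recently bound
    variable coming first; parameters from [V] are allowed. *)
Definition definable (n : nat) (phi : list zset -> Prop) : Prop :=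
  exists A ps, Forall V ps /\ forall e, env n e -> (sat V (e ++ ps) A <-> phi e).

Definition definable_term (n : nat) (t : list zset -> zset) : Prop :=
  (forall e, env n e -> V (t e)) /\
  definable (S n) (fun e => hd empty e = t (tl e)).

Lemma env_cons n x e : V x -> env n e -> env (S n) (x :: e).
Proof. intros Hx [H1 H2]; split; [simpl; congruence | now constructor]. Qed.

Lemma env_inv n e : env (S n) e -> exists x e', e = x :: e' /\ V x /\ env n e'.
Proof.
intros [H1 H2]; destruct e as [|x e]; [discriminate|]; inversion H2; subst.
exists x, e; repeat split; auto.
Qed.

Lemma env_nil : env 0 nil.
Proof. split; [reflexivity | constructor]. Qed.

Lemma env_tl n e : env (S n) e -> env n (tl e).
Proof. intros H; destruct (env_inv H) as [x [e' [-> [_ He]]]]; exact He. Qed.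

Lemma env_hd n e : env (S n) e -> V (hd empty e).
Proof. intros H; destruct (env_inv H) as [x [e' [-> [Hx _]]]]; exact Hx. Qed.

Lemma definable_ext n phi psi :
  definable n phi -> (forall e, env n e -> (phi e <-> psi e)) -> definable n psi.
Proof.
intros [A [ps [Hps H]]] K; exists A, ps; split; [exact Hps|].
intros e He; rewrite (H e He); auto.
Qed.

(** Permutation, duplication and weakening of variables all come from this. *)
Lemma definable_select n m phi (is : list nat) :
  definable n phi -> length is = n -> Forall (fun i => i < m) is ->
  definable m (fun e => phi (map (fun i => nth i e empty) is)).
Proof.
intros [A [ps [Hps H]]] Hn Hm.
(* The indices from [n] on point to the parameters, which now start at [m]. *)
set (r := fun j => if Nat.ltb j n then nth j is 0 else m + (j - n)).
exists (rename r A), ps; split; [exact Hps|]; intros e [Hl He].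
rewrite <- H.
- apply sat_rename; intros j; unfold r; destruct (Nat.ltb_spec j n) as [L|L].
  + rewrite app_nth1 by (rewrite length_map; lia).
    rewrite (nth_indep _ empty (nth 0 e empty)) by (rewrite length_map; lia).
    rewrite (map_nth (fun i => nth i e empty)).
    rewrite app_nth1; [reflexivity|].
    rewrite Hl; apply (proj1 (Forall_forall _ _) Hm), nth_In; lia.
  + rewrite !app_nth2 by (rewrite ?length_map; lia).
    f_equal; rewrite length_map; lia.
- split; [now rewrite length_map|].
  apply Forall_forall; intros x Hx; apply in_map_iff in Hx; destruct Hx as [i [<- Hi]].
  apply (proj1 (Forall_forall _ _) He), nth_In; rewrite Hl.
  now apply (proj1 (Forall_forall _ _) Hm).
Qed.

Lemma definable_common_parameters n phi psi :
  definable n phi -> definable n psi ->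
  exists A B ps, Forall V ps /\
    (forall e, env n e -> (sat V (e ++ ps) A <-> phi e)) /\
    (forall e, env n e -> (sat V (e ++ ps) B <-> psi e)).
Proof.
intros [A [ps [Hps HA]]] [B [qs [Hqs HB]]].
(* In [A], indices past [ps] denote [empty] and must be kept from falling into [qs]. *)
exists (rename (fun j => if Nat.ltb j (n + length ps) then j else j + length qs) A),
  (rename (fun j => if Nat.ltb j n then j else j + length ps) B), (ps ++ qs).
split; [now apply Forall_app|]; split; intros e He; pose proof (proj1 He) as Hl.
- rewrite <- HA by exact He; apply sat_rename; intros j.
  destruct (Nat.ltb_spec j (n + length ps)) as [L|L].
  + rewrite app_assoc, (app_nth1 (e ++ ps)); [reflexivity | rewrite length_app; lia].
  + rewrite !nth_overflow; [reflexivity | rewrite !length_app; lia ..].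
- rewrite <- HB by exact He; apply sat_rename; intros j.
  destruct (Nat.ltb_spec j n) as [L|L].
  + rewrite !app_nth1 by lia; reflexivity.
  + rewrite !app_nth2 by lia; f_equal; lia.
Qed.

Lemma definable_imp n phi psi : definable n phi -> definable n psi ->
  definable n (fun e => phi e -> psi e).
Proof.
intros H K; destruct (definable_common_parameters H K) as [A [B [ps [Hps [HA HB]]]]].
exists (fImp A B), ps; split; [exact Hps|]; intros e He; simpl.
now rewrite HA, HB.
Qed.

Lemma definable_False n : definable n (fun _ => False).
Proof. exists fBot, nil; split; [constructor | simpl; tauto]. Qed.

Lemma definable_not n phi : definable n phi -> definable n (fun e => ~ phi e).
Proof. intros H; exact (definable_imp H (definable_False n)). Qed.

Lemma definable_and n phi psi : definable n phi -> definable n psi ->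
  definable n (fun e => phi e /\ psi e).
Proof.
intros H K; apply definable_ext with (fun e => ~ (phi e -> ~ psi e)).
- now apply definable_not, definable_imp, definable_not.
- intros e _; tauto.
Qed.

Lemma definable_or n phi psi : definable n phi -> definable n psi ->
  definable n (fun e => phi e \/ psi e).
Proof.
intros H K; apply definable_ext with (fun e => ~ phi e -> psi e).
- now apply definable_imp; [apply definable_not|].
- intros e _; tauto.
Qed.

Lemma definable_iff n phi psi : definable n phi -> definable n psi ->
  definable n (fun e => phi e <-> psi e).
Proof. intros H K; apply definable_and; now apply definable_imp. Qed.

Lemma definable_forall n (phi : list zset -> zset -> Prop) :
  definable (S n) (fun e => phi (tl e) (hd empty e)) ->
  definable n (fun e => forall x, V x -> phi e x).
Proof.
intros [A [ps [Hps H]]]; exists (fAll A), ps; split; [exact Hps|].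
intros e He; simpl; split; intros K x Hx; specialize (K x Hx).
- exact (proj1 (H (x :: e) (env_cons Hx He)) K).
- exact (proj2 (H (x :: e) (env_cons Hx He)) K).
Qed.

Lemma definable_exists n (phi : list zset -> zset -> Prop) :
  definable (S n) (fun e => phi (tl e) (hd empty e)) ->
  definable n (fun e => exists x, V x /\ phi e x).
Proof.
intros H; apply definable_ext with (fun e => ~ forall x, V x -> ~ phi e x).
- apply definable_not, (definable_forall (phi := fun e x => ~ phi e x)).
  now apply definable_not.
- intros e _; split.
  + intros K; apply NNPP; intros N; apply K; intros x Hx Hp; apply N; eauto.
  + intros [x [Hx Hp]] K; exact (K x Hx Hp).
Qed.

Lemma definable_atom n (phi : list zset -> Prop) i j (b : bool) : i < n -> j < n ->
  definable n (fun e => if b then nth i e empty ∈ nth j e empty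
                        else nth i e empty = nth j e empty).
Proof.
intros Hi Hj; exists (if b then fMem i j else fEq i j), nil; split; [constructor|].
intros e [Hl _]; rewrite app_nil_r; destruct b; simpl; tauto.
Qed.

Lemma map_nth_seq (d e : list zset) :
  map (fun i => nth i (d ++ e) empty) (seq (length d) (length e)) = e.
Proof.
induction d as [|y d IH]; simpl.
- induction e as [|x e IH]; simpl; [reflexivity|].
  now rewrite <- seq_shift, map_map, IH.
- now rewrite <- seq_shift, map_map.
Qed.

(** Weakening under one bound variable, as needed for the graphs of terms. *)
Lemma definable_skip n phi : definable (S n) phi ->
  definable (S (S n)) (fun e => phi (hd empty e :: tl (tl e))).
Proof.
intros H; pose proof (@definable_select (S n) (S (S n)) _ (0 :: seq 2 n) H) as K.
apply definable_ext with (1 := K ltac:(simpl; now rewrite length_seq)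
  ltac:(constructor; [lia|]; apply Forall_forall; intros i Hi; apply in_seq in Hi; lia)).
intros e He; destruct (env_inv He) as [x [e' [-> [_ He']]]].
destruct (env_inv He') as [y [e'' [-> [_ [Hl _]]]]]; rewrite <- Hl.
pose proof (map_nth_seq (x :: y :: nil) e'') as E.
change (map (fun i => nth i (x :: y :: e'') empty) (seq 2 (length e'')) = e'') in E.
cbn [map]; rewrite E; simpl; tauto.
Qed.

Lemma definable_swap n phi : definable (S (S n)) phi ->
  definable (S (S n)) (fun e => phi (hd empty (tl e) :: hd empty e :: tl (tl e))).
Proof.
intros H; pose proof (@definable_select (S (S n)) (S (S n)) _ (1 :: 0 :: seq 2 n) H) as K.
apply definable_ext with (1 := K ltac:(simpl; now rewrite length_seq)
  ltac:(constructor; [lia|]; constructor; [lia|]; apply Forall_forall;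
    intros i Hi; apply in_seq in Hi; lia)).
intros e He; destruct (env_inv He) as [x [e' [-> [_ He']]]].
destruct (env_inv He') as [y [e'' [-> [_ [Hl _]]]]]; rewrite <- Hl.
pose proof (map_nth_seq (x :: y :: nil) e'') as E.
change (map (fun i => nth i (x :: y :: e'') empty) (seq 2 (length e'')) = e'') in E.
cbn [map]; rewrite E; simpl; tauto.
Qed.

Lemma definable_term_weaken n t :
  definable_term n t -> definable_term (S n) (fun e => t (tl e)).
Proof.
intros [H1 H2]; split; [intros e He; apply H1, (env_tl He) | exact (definable_skip H2)].
Qed.

Lemma definable_var n : definable_term (S n) (hd empty).
Proof.
split; [intros e He; apply (env_hd He)|].
apply definable_ext with (1 := @definable_atom (S (S n)) (fun _ => True) 0 1 false
  ltac:(lia) ltac:(lia)).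
intros e He; destruct (env_inv He) as [x [e' [-> [_ He']]]].
destruct (env_inv He') as [y [e'' [-> _]]]; simpl; tauto.
Qed.

Lemma definable_const n c : V c -> definable_term n (fun _ => c).
Proof.
intros Hc; split; [auto|]; exists (fEq 0 (S n)), (c :: nil); split; [now repeat constructor|].
intros e He; destruct (env_inv He) as [x [e' [-> [_ [Hl _]]]]]; simpl.
rewrite app_nth2 by lia; rewrite Hl, Nat.sub_diag; simpl; tauto.
Qed.

Lemma definable_subst n phi t : definable (S n) phi -> definable_term n t ->
  definable n (fun e => phi (t e :: e)).
Proof.
intros H [K1 K2].
apply definable_ext with (fun e => exists x, V x /\ x = t e /\ phi (x :: e)).
- apply (definable_exists (phi := fun e x => x = t e /\ phi (x :: e))).
  apply definable_and; [exact K2|]; apply definable_ext with (1 := H).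
  intros e He; destruct (env_inv He) as [x [e' [-> _]]]; simpl; tauto.
- intros e He; split; [intros [x [_ [-> Hx]]]; exact Hx|].
  intros Hx; exists (t e); auto.
Qed.

Lemma definable_atom_terms n s t (b : bool) : definable_term n s -> definable_term n t ->
  definable n (fun e => if b then s e ∈ t e else s e = t e).
Proof.
intros Hs Ht.
assert (H : definable (S n) (fun e => if b then hd empty e ∈ t (tl e)
  else hd empty e = t (tl e))).
{ destruct b; [|apply Ht].
  apply definable_ext with (fun e => nth 0 (t (tl e) :: e) empty ∈ nth 0 (t (tl e) :: e) empty
    \/ nth 1 (t (tl e) :: e) empty ∈ nth 0 (t (tl e) :: e) empty).
  - apply (definable_subst (phi := fun e => nth 0 e empty ∈ nth 0 e empty \/
      nth 1 e empty ∈ nth 0 e empty)); [|now apply definable_term_weaken].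
    apply definable_or; [apply (@definable_atom _ (fun _ => True) 0 0 true); lia|].
    apply (@definable_atom _ (fun _ => True) 1 0 true); lia.
  - intros e He; destruct (env_inv He) as [x [e' [-> _]]]; simpl.
    split; [intros [H|H]; [|exact H]|now right].
    destruct (@tmem_irrefl (t e')); now apply t_step. }
exact (definable_subst H Hs).
Qed.

Lemma definable_mem n s t : definable_term n s -> definable_term n t ->
  definable n (fun e => s e ∈ t e).
Proof. exact (@definable_atom_terms n s t true). Qed.

Lemma definable_eq n s t : definable_term n s -> definable_term n t ->
  definable n (fun e => s e = t e).
Proof. exact (@definable_atom_terms n s t false). Qed.

Hypothesis hV : ZF_model V.

Lemma V_elt x y : V x -> y ∈ x -> V y.
Proof. exact (@ZF_transitive V hV x y). Qed.

Lemma V_components a b : V ⟨a, b⟩ -> V a /\ V b.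
Proof.
intros H; assert (K : V (upair a b)).
{ apply (V_elt H); unfold opair; apply mem_upair; auto. }
split; apply (V_elt K), mem_upair; auto.
Qed.

Lemma V_pair_elt a b x : V x -> ⟨a, b⟩ ∈ x -> V a /\ V b.
Proof. intros Hx H; exact (V_components (V_elt Hx H)). Qed.

(** The axioms relativized to [V] describe sets by their elements in [V]; this turns
    them into closure of [V] under the operations of the universe. *)
Lemma V_same x c : V c -> (forall z, z ∈ x -> V z) ->
  (forall z, V z -> (z ∈ c <-> z ∈ x)) -> V x.
Proof.
intros Hc Hx H; replace x with c; [exact Hc|]; apply zset_ext; intros z; split; intros Hz.
- apply H; [exact (V_elt Hc Hz) | exact Hz].
- apply H; auto.
Qed.

Lemma V_upair a b : V a -> V b -> V (upair a b).
Proof.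
intros Ha Hb; destruct (ZF_pair hV Ha Hb) as [c [Hc H]]; apply V_same with c; auto.
- intros z Hz; apply mem_upair in Hz; destruct Hz; now subst.
- intros z Hz; rewrite mem_upair; auto.
Qed.

Lemma V_opair a b : V a -> V b -> V ⟨a, b⟩.
Proof. intros Ha Hb; unfold opair; now repeat apply V_upair. Qed.

Lemma V_bigcup x : V x -> V (⋃ x).
Proof.
intros Hx; destruct (ZF_union hV Hx) as [c [Hc H]]; apply V_same with c; auto.
- intros z Hz; apply mem_bigcup in Hz; destruct Hz as [y [Hy Hz]].
  exact (V_elt (V_elt Hx Hy) Hz).
- intros z Hz; rewrite H, mem_bigcup by exact Hz; split.
  + intros [y [_ K]]; eauto.
  + intros [y [K L]]; exists y; split; [exact (V_elt Hx K) | auto].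
Qed.

Lemma V_union2 x y : V x -> V y -> V (union2 x y).
Proof. intros Hx Hy; now apply V_bigcup, V_upair. Qed.

Lemma V_power x : V x -> exists c, V c /\ forall z, z ∈ c <-> V z /\ z ⊆ x.
Proof.
intros Hx; destruct (ZF_power hV Hx) as [c [Hc H]]; exists c; split; [exact Hc|].
intros z; split.
- intros Hz; pose proof (V_elt Hc Hz) as K; split; [exact K|].
  intros w Hw; apply (proj1 (H z K) Hz); [exact (V_elt K Hw) | exact Hw].
- intros [K L]; apply (H z K); auto.
Qed.

Lemma V_sep_env n x phi e : V x -> env n e -> definable (S n) phi ->
  V (sep x (fun z => phi (z :: e))).
Proof.
intros Hx He [A [ps [Hps H]]].
assert (Hf : Forall V (e ++ ps)) by (apply Forall_app; split; [apply He | exact Hps]).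
destruct (ZF_sep hV A Hf Hx) as [c [Hc K]]; apply V_same with c; [exact Hc| |].
- intros z Hz; apply mem_sep in Hz; exact (V_elt Hx (proj1 Hz)).
- intros z Hz; rewrite (K z Hz), mem_sep; apply and_iff_compat_l.
  exact (H (z :: e) (env_cons Hz He)).
Qed.

Lemma V_sep x (Q : zset -> Prop) : V x -> definable 1 (fun e => Q (hd empty e)) ->
  V (sep x Q).
Proof. intros Hx H; exact (V_sep_env Hx env_nil H). Qed.

Lemma V_image_env n x phi e (f : zset -> zset) : V x -> env n e ->
  definable (S (S n)) phi ->
  (forall y, y ∈ x -> V (f y)) ->
  (forall y v, y ∈ x -> V v -> (phi (y :: v :: e) <-> v = f y)) ->
  V (image f x).
Proof.
intros Hx He [A [ps [Hps H]]] Hf Hphi.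
assert (Hl : Forall V (e ++ ps)) by (apply Forall_app; split; [apply He | exact Hps]).
assert (K : forall y v, y ∈ x -> V v -> (sat V (y :: v :: e ++ ps) A <-> v = f y)).
{ intros y v Hy Hv; rewrite <- Hphi by assumption.
  exact (H (y :: v :: e) (env_cons (V_elt Hx Hy) (env_cons Hv He))). }
destruct (ZF_repl hV (A := A) Hl Hx) as [c [Hc L]].
{ intros y _ Hy; exists (f y); split; [split; [auto | now apply K; auto]|].
  intros v [Hv Hs]; symmetry; now apply (K y v). }
apply V_same with c; [exact Hc| |].
- intros z Hz; apply mem_image in Hz; destruct Hz as [y [Hy <-]]; auto.
- intros z Hz; rewrite (L z Hz), mem_image; split.
  + intros [y [_ [Hy Hs]]]; exists y; split; [exact Hy|]; symmetry; now apply (K y z).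
  + intros [y [Hy <-]]; exists y; split; [exact (V_elt Hx Hy)|]; split; [exact Hy|].
    now apply K.
Qed.

(** Replacement for an [f] that is known to be definable on [x] only, which is the
    situation inside a proof by induction that [f] maps [V] to [V]. *)
Lemma V_image_on x phi (f : zset -> zset) : V x -> definable 2 phi ->
  (forall y, y ∈ x -> V (f y)) ->
  (forall y v, y ∈ x -> V v -> (phi (y :: v :: nil) <-> v = f y)) ->
  V (image f x).
Proof. intros Hx; exact (V_image_env Hx env_nil). Qed.

Lemma definable_forall_in n t (phi : list zset -> zset -> Prop) :
  definable_term n t -> definable (S n) (fun e => phi (tl e) (hd empty e)) ->
  definable n (fun e => forall x, x ∈ t e -> phi e x).
Proof.
intros Ht H; apply definable_ext with (fun e => forall x, V x -> x ∈ t e -> phi e x).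
- apply (definable_forall (phi := fun e x => x ∈ t e -> phi e x)), definable_imp; auto.
  apply definable_mem; [apply definable_var | now apply definable_term_weaken].
- intros e He; split; intros K x; auto; intros Hx; apply K; auto.
  exact (V_elt (proj1 Ht e He) Hx).
Qed.

Lemma definable_exists_in n t (phi : list zset -> zset -> Prop) :
  definable_term n t -> definable (S n) (fun e => phi (tl e) (hd empty e)) ->
  definable n (fun e => exists x, x ∈ t e /\ phi e x).
Proof.
intros Ht H; apply definable_ext with (fun e => exists x, V x /\ x ∈ t e /\ phi e x).
- apply (definable_exists (phi := fun e x => x ∈ t e /\ phi e x)), definable_and; auto.
  apply definable_mem; [apply definable_var | now apply definable_term_weaken].
- intros e He; split; intros [x K]; exists x; [tauto|].
  split; [exact (V_elt (proj1 Ht e He) (proj1 K)) | exact K].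
Qed.

(** By extensionality, it is enough to define membership in the value. *)
Lemma definable_term_by_elements n t : (forall e, env n e -> V (t e)) ->
  definable (S n) (fun e => hd empty e ∈ t (tl e)) -> definable_term n t.
Proof.
intros HV H; split; [exact HV|].
apply definable_ext with (fun e => forall z, V z -> (z ∈ hd empty e <-> z ∈ t (tl e))).
- apply (definable_forall (phi := fun e z => z ∈ hd empty e <-> z ∈ t (tl e))).
  apply definable_iff.
  + apply definable_mem; [apply definable_var|].
    apply (definable_term_weaken (t := hd empty)), definable_var.
  + exact (definable_skip H).
- intros e He; destruct (env_inv He) as [x [e' [-> [Hx He']]]]; simpl; split.
  + intros K; apply zset_ext; intros z; split; intros Hz; apply K; auto.
    * exact (V_elt Hx Hz).
    * exact (V_elt (HV e' He') Hz).
  + intros ->; tauto.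
Qed.

Lemma definable_upair n s t : definable_term n s -> definable_term n t ->
  definable_term n (fun e => upair (s e) (t e)).
Proof.
intros Hs Ht; apply definable_term_by_elements.
- intros e He; apply V_upair; [now apply Hs | now apply Ht].
- apply definable_ext with (fun e => hd empty e = s (tl e) \/ hd empty e = t (tl e)).
  + apply definable_or; apply definable_eq;
      solve [apply definable_var | now apply definable_term_weaken].
  + intros e _; symmetry; apply mem_upair.
Qed.

Lemma definable_opair n s t : definable_term n s -> definable_term n t ->
  definable_term n (fun e => ⟨s e, t e⟩).
Proof. intros Hs Ht; apply definable_upair; now apply definable_upair. Qed.

Lemma definable_bigcup n t : definable_term n t ->
  definable_term n (fun e => ⋃ t e).
Proof.
intros Ht; apply definable_term_by_elements.
- intros e He; now apply V_bigcup, Ht.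
- apply definable_ext with (fun e => exists y, y ∈ t (tl e) /\ hd empty e ∈ y).
  + apply (definable_exists_in (t := fun e => t (tl e)) (phi := fun e y => hd empty e ∈ y));
      [now apply definable_term_weaken|].
    apply definable_mem; [apply (definable_term_weaken (t := hd empty))|];
      apply definable_var.
  + intros e _; symmetry; apply mem_bigcup.
Qed.

Lemma definable_sep n t (phi : list zset -> zset -> Prop) :
  definable_term n t -> definable (S n) (fun e => phi (tl e) (hd empty e)) ->
  definable_term n (fun e => sep (t e) (fun z => phi e z)).
Proof.
intros Ht H; apply definable_term_by_elements.
- intros e He; exact (V_sep_env (proj1 Ht e He) He H).
- apply definable_ext with (fun e => hd empty e ∈ t (tl e) /\ phi (tl e) (hd empty e)).
  + apply definable_and; [|exact H]; apply definable_mem; [apply definable_var|].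
    now apply definable_term_weaken.
  + intros e _; symmetry; exact (mem_sep (t (tl e)) (phi (tl e)) (hd empty e)).
Qed.

Lemma definable_image n t (f : list zset -> zset -> zset) :
  definable_term n t -> definable_term (S n) (fun e => f (tl e) (hd empty e)) ->
  definable_term n (fun e => image (fun z => f e z) (t e)).
Proof.
intros Ht [H1 H2]; apply definable_term_by_elements.
- intros e He; apply (V_image_env (n := n) (e := e) (proj1 Ht e He) He (definable_swap H2)).
  + intros y Hy; exact (H1 (y :: e) (env_cons (V_elt (proj1 Ht e He) Hy) He)).
  + intros y v _ _; simpl; tauto.
- apply definable_ext with
    (fun e => exists y, y ∈ t (tl e) /\ hd empty e = f (tl e) y).
  + apply (definable_exists_in (t := fun e => t (tl e))
      (phi := fun e y => hd empty e = f (tl e) y)); [now apply definable_term_weaken|].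
    apply definable_ext with (1 := definable_swap H2).
    intros e He; destruct (env_inv He) as [x [e' [-> [_ He']]]].
    destruct (env_inv He') as [y [e'' [-> _]]]; simpl; tauto.
  + intros e _; rewrite mem_image; split; intros [y [Hy E]]; exists y; auto.
Qed.

(** The quantifiers are unbounded, but the pairs in a set of [V] have both components
    in [V]. *)
Lemma definable_exists_pair n t (phi : list zset -> zset -> zset -> Prop) :
  definable_term n t ->
  definable (S (S n)) (fun e => phi (tl (tl e)) (hd empty (tl e)) (hd empty e)) ->
  definable n (fun e => exists a b, ⟨a, b⟩ ∈ t e /\ phi e a b).
Proof.
intros Ht H.
apply definable_ext with
  (fun e => exists a, V a /\ exists b, V b /\ ⟨a, b⟩ ∈ t e /\ phi e a b).
- apply (definable_exists (phi := fun e a => exists b, V b /\ ⟨a, b⟩ ∈ t e /\ phi e a b)).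
  apply (definable_exists (phi := fun e b =>
    ⟨hd empty e, b⟩ ∈ t (tl e) /\ phi (tl e) (hd empty e) b)).
  apply definable_and; [|exact H].
  apply definable_mem; [apply definable_opair|
    now apply (definable_term_weaken (t := fun e => t (tl e))), definable_term_weaken].
  + apply (definable_term_weaken (t := hd empty)), definable_var.
  + apply definable_var.
- intros e He; split; [intros [a [_ [b [_ K]]]]; eauto|].
  intros [a [b [K L]]]; destruct (V_pair_elt (proj1 Ht e He) K); eauto 7.
Qed.

Lemma definable_forall_pair n t (phi : list zset -> zset -> zset -> Prop) :
  definable_term n t ->
  definable (S (S n)) (fun e => phi (tl (tl e)) (hd empty (tl e)) (hd empty e)) ->
  definable n (fun e => forall a b, ⟨a, b⟩ ∈ t e -> phi e a b).
Proof.
intros Ht H.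
apply definable_ext with (fun e => ~ exists a b, ⟨a, b⟩ ∈ t e /\ ~ phi e a b).
- apply definable_not, (definable_exists_pair (phi := fun e a b => ~ phi e a b)); auto.
  now apply definable_not.
- intros e He; split.
  + intros K a b Hab; apply NNPP; intros N; apply K; eauto.
  + intros K [a [b [Hab N]]]; auto.
Qed.


Lemma V_empty : V empty.
Proof.
destruct (ZF_inf hV) as [_ [_ [[x [Hx [_ H]]] _]]]; replace empty with x; [exact Hx|].
apply zset_ext; intros z; split; intros Hz.
- destruct (H z (V_elt Hx Hz) Hz).
- destruct (not_mem_empty Hz).
Qed.

Local Hint Resolve V_upair V_opair V_bigcup V_union2 V_empty : model.

(** Abstracts [tl e] from a term all of whose variables come from [tl e]. *)
Ltac weaken_term :=
  lazymatch goal with |- definable_term _ ?f =>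
    let g := constr:(fun e : list zset => ltac:(
      let b := eval cbv beta in (f e) in
      let p := eval pattern (tl e) in b in
      lazymatch p with ?h _ => exact h end)) in
    lazymatch g with fun _ => ?h => apply (@definable_term_weaken _ h) end
  end.

(** Redefined as further notions are proved definable. *)
Ltac definable_known := fail.

Ltac definable_step :=
  cbv beta;
  lazymatch goal with
  | |- definable _ (fun e => False) => apply definable_False
  | |- definable _ (fun e => _ /\ _) => apply definable_and
  | |- definable _ (fun e => _ \/ _) => apply definable_or
  | |- definable _ (fun e => _ <-> _) => apply definable_iff
  | |- definable _ (fun e => ~ _) => apply definable_not
  | |- definable _ (fun e => _ = _) => apply definable_eq
  | |- definable _ (fun e => _ ∈ _) => apply definable_mem
  | |- definable _ (fun e => _ ⊆ _) => unfold subset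
  | |- definable _ (fun e => forall a b, ⟨a, b⟩ ∈ _ -> _) => apply definable_forall_pair
  | |- definable _ (fun e => forall x, x ∈ _ -> _) => apply definable_forall_in
  | |- definable _ (fun e => forall x, V x -> _) => apply definable_forall
  | |- definable _ (fun e => exists a b, ⟨a, b⟩ ∈ _ /\ _) => apply definable_exists_pair
  | |- definable _ (fun e => exists x, x ∈ _ /\ _) => apply definable_exists_in
  | |- definable _ (fun e => exists x, V x /\ _) => apply definable_exists
  | |- definable_term _ (fun e => upair _ _) => apply definable_upair
  | |- definable_term _ (fun e => ⟨_, _⟩) => apply definable_opair
  | |- definable_term _ (fun e => ⋃ _) => apply definable_bigcup
  | |- definable_term _ (fun e => sep _ _) => apply definable_sep
  | |- definable_term _ (fun e => image _ _) => apply definable_image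
  | |- _ => first
    [ assumption | apply definable_var
    | apply definable_const; solve [auto with model]
    | definable_known
    | lazymatch goal with |- definable_term _ _ => weaken_term end
    | lazymatch goal with |- definable _ (fun e => _ -> _) => apply definable_imp end ]
  end.

Ltac definability := repeat definable_step.

Lemma definable_app n s t : definable_term n s -> definable_term n t ->
  definable_term n (fun e => app (s e) (t e)).
Proof. intros Hs Ht; unfold app; definability. Qed.

Lemma definable_zfst n t : definable_term n t -> definable_term n (fun e => zfst (t e)).
Proof. intros Ht; unfold zfst; definability. Qed.

Lemma definable_zsnd n t : definable_term n t -> definable_term n (fun e => zsnd (t e)).
Proof. intros Ht; unfold zsnd; definability. Qed.

Lemma definable_pairs n t : definable_term n t -> definable_term n (fun e => pairs (t e)).
Proof. intros Ht; unfold pairs; definability. Qed.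

Lemma definable_transitive n t : definable_term n t ->
  definable n (fun e => transitive_set (t e)).
Proof. intros Ht; unfold transitive_set; definability. Qed.

Lemma definable_isfun n t : definable_term n t -> definable n (fun e => isfun (t e)).
Proof.
intros Ht; apply definable_ext with (fun e =>
  (forall w, w ∈ t e -> w ∈ pairs (t e)) /\
  (forall x y, ⟨x, y⟩ ∈ t e -> forall x' y', ⟨x', y'⟩ ∈ t e -> x = x' -> y = y')).
- pose proof (definable_pairs Ht); definability.
- intros e _; unfold isfun; split; intros [H K]; split.
  + intros w Hw; exact (proj2 (proj1 (mem_pairs _ _) (H w Hw))).
  + intros x y y' Hy Hy'; exact (K x y Hy x y' Hy' eq_refl).
  + intros w Hw; apply mem_pairs; auto.
  + intros x y Hy x' y' Hy' ->; exact (K x' y y' Hy Hy').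
Qed.

Lemma fdom_eq f : fdom f = image zfst (pairs f).
Proof.
apply zset_ext; intros x; rewrite mem_fdom, mem_image; split.
- intros [y H]; exists ⟨x, y⟩; split; [apply mem_pairs; eauto | apply zfst_pair].
- intros [w [Hw <-]]; apply mem_pairs in Hw; destruct Hw as [Hw [a [b ->]]].
  rewrite zfst_pair; eauto.
Qed.

Lemma definable_fdom n t : definable_term n t -> definable_term n (fun e => fdom (t e)).
Proof.
intros Ht; rewrite (functional_extensionality (fun e => fdom (t e)) _ (fun e => fdom_eq (t e))).
pose proof (definable_pairs Ht) as Hp; apply definable_image; [exact Hp|].
apply definable_zfst, definable_var.
Qed.

Ltac definable_set := lazymatch goal with
  | |- definable_term _ (fun e => app _ _) => apply definable_app
  | |- definable_term _ (fun e => zfst _) => apply definable_zfst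
  | |- definable_term _ (fun e => zsnd _) => apply definable_zsnd
  | |- definable_term _ (fun e => fdom _) => apply definable_fdom
  | |- definable_term _ (fun e => pairs _) => apply definable_pairs
  | |- definable_term _ (fun e => graph _ _) => unfold graph
  | |- definable_term _ (fun e => union2 _ _) => unfold union2
  | |- definable_term _ (fun e => prod _ _) => unfold prod
  | |- definable _ (fun e => isfun _) => apply definable_isfun
  | |- definable _ (fun e => transitive_set _) => apply definable_transitive
  | |- definable _ (fun e => next_in _ _ _) => unfold next_in
  end.

Ltac definable_known ::= definable_set.

Lemma V_image x (f : zset -> zset) : V x ->
  definable_term 1 (fun e => f (hd empty e)) -> V (image f x).
Proof.
intros Hx Hf.
assert (H : definable_term 0 (fun _ => image f x)).
{ apply (definable_image (t := fun _ => x) (f := fun _ => f)); [|exact Hf].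
  now apply definable_const. }
exact (proj1 H nil env_nil).
Qed.

Lemma V_term (c : zset) : definable_term 0 (fun _ => c) -> V c.
Proof. intros H; exact (proj1 H nil env_nil). Qed.

Lemma V_prod a b : V a -> V b -> V (prod a b).
Proof.
intros Ha Hb; unfold prod; apply V_bigcup, V_image; [exact Ha|]; definability.
Qed.

(** * Recursion in a model *)

(** Replacement applies since, in [V], the closure of [y] is the least transitive set
    including [y]. *)
Lemma V_tcl x : V x -> V (tcl x).
Proof.
induction (mem_wf x) as [x _ IH]; intros Hx; rewrite tcl_eq.
apply V_union2, V_bigcup; [exact Hx|].
apply V_image_on with (x := x) (phi := fun e =>
  (transitive_set (hd empty (tl e)) /\ hd empty e ⊆ hd empty (tl e)) /\
  forall t, V t -> transitive_set t -> hd empty e ⊆ t -> hd empty (tl e) ⊆ t); auto.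
- definability.
- intros y Hy; apply IH; [exact Hy | exact (V_elt Hx Hy)].
- intros y v Hy Hv; simpl; pose proof (V_elt Hx Hy) as Vy; split.
  + intros [[H1 H2] H3]; apply zset_ext; intros z; split; intros Hz.
    * apply H3; auto; [apply tcl_transitive|].
      intros u Hu; apply mem_tcl; now apply t_step.
    * apply mem_tcl, tmem_inv in Hz; destruct Hz as [Hz | [u [Hu Hz]]]; [auto|].
      exact (transitive_set_tmem H1 (H2 u Hu) Hz).
  + intros ->; split; [split; [apply tcl_transitive|]|].
    * intros u Hu; apply mem_tcl; now apply t_step.
    * intros t _ Ht Hyt u Hu; apply mem_tcl, tmem_inv in Hu.
      destruct Hu as [Hu | [w [Hw Hu]]]; [auto|].
      exact (transitive_set_tmem Ht (Hyt w Hw) Hu).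
Qed.

(** Definability of functions given by recursion along the transitive closure, with a
    parameter [c].  As [app] is total, an approximation on [T] need not be a function
    with domain [T]. *)
Section Recursion.
Variable (f : zset -> zset -> zset) (g : zset -> zset -> zset -> zset).
Hypothesis f_rec : forall c x h,
  (forall z, tmem z x -> app h z = f c z) -> f c x = g c x h.
Hypothesis g_definable : forall n a s t, definable_term n a -> definable_term n s ->
  definable_term n t -> definable_term n (fun e => g (a e) (s e) (t e)).

Definition attempt (c T h : zset) : Prop :=
  transitive_set T /\ forall y, y ∈ T -> app h y = g c y h.

Lemma definable_attempt n a s t : definable_term n a -> definable_term n s ->
  definable_term n t -> definable n (fun e => attempt (a e) (s e) (t e)).
Proof.
intros Ha Hs Ht; unfold attempt.
apply definable_and; [definability|].
apply definable_forall_in; [definability|].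
apply definable_eq; [definability|]; cbv beta; apply g_definable; definability.
Qed.

(** This makes the values of all approximations agree. *)
Lemma attempt_correct c T h : attempt c T h -> forall y, y ∈ T -> app h y = f c y.
Proof.
intros [HT H] y; induction (tmem_wf y) as [y _ IH]; intros Hy.
rewrite H by exact Hy; symmetry; apply f_rec; intros z Hz.
apply IH; [exact Hz|]; exact (transitive_set_tmem HT Hy Hz).
Qed.

Lemma attempt_graph c T : transitive_set T -> attempt c T (graph (f c) T).
Proof.
intros HT; split; [exact HT|]; intros y Hy; rewrite app_graph by exact Hy.
apply f_rec; intros z Hz; apply app_graph; exact (transitive_set_tmem HT Hy Hz).
Qed.

Definition attempted (c x v : zset) : Prop :=
  exists T, V T /\ exists h, V h /\ attempt c T h /\ x ∈ T /\ v = app h x.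

Lemma definable_attempted n a s t : definable_term n a -> definable_term n s ->
  definable_term n t -> definable n (fun e => attempted (a e) (s e) (t e)).
Proof.
intros Ha Hs Ht; unfold attempted; definability.
cbv beta; apply definable_attempt; definability.
Qed.

(** The approximations for the elements of [tcl x] are united by replacement, and the
    value at [x] is added. *)
Lemma recursion_attempted c x : V c -> V x -> V (f c x) /\ attempted c x (f c x).
Proof.
intros Hc; induction (tmem_wf x) as [x _ IH]; intros Hx.
pose proof (V_tcl Hx) as HT.
assert (IH' : forall y, y ∈ tcl x -> V (f c y) /\ attempted c y (f c y)).
{ intros y Hy; apply IH; [now apply mem_tcl | exact (V_elt HT Hy)]. }
assert (Hg : V (graph (f c) (tcl x))).
{ apply V_image_on with (phi := fun e => exists v, V v /\ attempted c (hd empty e) v /\ hd empty (tl e) = ⟨hd empty e, v⟩); [exact HT | | |].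
  - definability; cbv beta; apply definable_attempted; definability.
  - intros y Hy; apply V_opair; [exact (V_elt HT Hy) | now apply IH'].
  - intros y w Hy Hw; simpl; split.
    + intros [v [_ [[T [_ [h [_ [Ha [HyT ->]]]]]] ->]]].
      now rewrite (attempt_correct Ha HyT).
    + intros ->; exists (f c y); split; [now apply IH' | split; [now apply IH'|reflexivity]]. }
assert (Hv : V (f c x)).
{ rewrite (@f_rec c x (graph (f c) (tcl x))).
  - apply V_term, g_definable; now apply definable_const.
  - intros z Hz; apply app_graph; now apply mem_tcl. }
split; [exact Hv|].
set (T := union2 (tcl x) (upair x x)).
exists T; split; [unfold T; auto with model|].
exists (union2 (graph (f c) (tcl x)) (upair ⟨x, f c x⟩ ⟨x, f c x⟩)).
split; [auto 6 with model|].
replace (union2 _ _) with (graph (f c) T).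
- assert (HxT : x ∈ T) by (apply mem_union2; right; apply mem_upair; auto).
  split; [|split; [exact HxT | symmetry; now apply app_graph]].
  apply attempt_graph; intros y Hy z Hz; apply mem_union2; left; apply mem_tcl.
  apply mem_union2 in Hy; destruct Hy as [Hy | Hy].
  + apply mem_tcl; exact (tcl_transitive Hy Hz).
  + apply t_step; apply mem_upair in Hy; destruct Hy; now subst.
- apply zset_ext; intros w; unfold graph, T.
  rewrite mem_union2, !mem_image, mem_upair; split.
  + intros [y [Hy <-]]; apply mem_union2 in Hy; rewrite mem_upair in Hy.
    destruct Hy as [Hy | [-> | ->]]; [left; eauto | auto ..].
  + intros [[y [Hy <-]] | [-> | ->]]; [exists y | exists x ..];
      rewrite mem_union2, mem_upair; auto.
Qed.

Lemma definable_recursion n a s : definable_term n a -> definable_term n s ->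
  definable_term n (fun e => f (a e) (s e)).
Proof.
intros Ha Hs; split.
- intros e He; apply recursion_attempted; [now apply Ha | now apply Hs].
- apply definable_ext with (fun e => attempted (a (tl e)) (s (tl e)) (hd empty e)).
  + apply definable_attempted; definability.
  + intros e He; apply env_tl in He as He'.
    assert (K := recursion_attempted (proj1 Ha _ He') (proj1 Hs _ He')).
    split; [|intros ->; apply K].
    intros [T [_ [h [_ [Hat [HxT ->]]]]]]; exact (attempt_correct Hat HxT).
Qed.

End Recursion.

(** * The action of automorphisms on names *)

Lemma act_rec f x h :
  (forall z, tmem z x -> app h z = act f z) ->
  act f x = image (fun w => ⟨app f (zfst w), app h (zsnd w)⟩) (pairs x).
Proof.
intros H; apply zset_ext; intros w; rewrite mem_act, mem_image; split.
- intros [p [y [Hy ->]]]; exists ⟨p, y⟩; split; [apply mem_pairs; eauto|].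
  rewrite zfst_pair, zsnd_pair, H; [reflexivity|].
  apply subname_tmem; now exists p.
- intros [z [Hz <-]]; apply mem_pairs in Hz; destruct Hz as [Hz [p [y ->]]].
  exists p, y; split; [exact Hz|].
  rewrite zfst_pair, zsnd_pair, H; [reflexivity|].
  apply subname_tmem; now exists p.
Qed.

Lemma definable_act n s t : definable_term n s -> definable_term n t ->
  definable_term n (fun e => act (s e) (t e)).
Proof.
intros Hs Ht; apply (definable_recursion (f := act)
  (g := fun f x h => image (fun w => ⟨app f (zfst w), app h (zsnd w)⟩) (pairs x)));
  [exact act_rec | | exact Hs | exact Ht].
intros m a b c Ha Hb Hc; definability.
Qed.

(** The canonical name of a set of the ground model, when [m] is the maximal
    condition; see [mem_check] for the recursion equation. *)
Definition check (m : zset) : zset -> zset :=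
  Fix mem_wf (fun _ => zset) (fun x rec =>
    collect (fun i : idx x => ⟨m, rec (elt i) (mem_idx i)⟩)).

Lemma mem_check m x z : z ∈ check m x <-> exists y, y ∈ x /\ z = ⟨m, check m y⟩.
Proof.
unfold check; rewrite Fix_eq.
- fold (check m); rewrite mem_collect; split.
  + intros [i <-]; exists (elt i); split; [apply mem_idx | reflexivity].
  + intros [y [[i <-] ->]]; now exists i.
- intros x' g h Hgh; f_equal; apply functional_extensionality; intros i; now rewrite Hgh.
Qed.

Lemma definable_check n s t : definable_term n s -> definable_term n t ->
  definable_term n (fun e => check (s e) (t e)).
Proof.
intros Hs Ht; apply (definable_recursion (f := check)
  (g := fun m x h => image (fun y => ⟨m, app h y⟩) x)); [| | exact Hs | exact Ht].
- intros m x h H; apply zset_ext; intros w; rewrite mem_check, mem_image.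
  split; intros [y [Hy E]]; exists y; (split; [exact Hy|]).
  + rewrite H; [now symmetry | now apply t_step].
  + rewrite <- E, H; [reflexivity | now apply t_step].
- intros m a b c Ha Hb Hc; definability.
Qed.

Variable S : system.
Hypothesis hS : symmetric_system V S.
Variable one : zset.
Hypothesis one_cond : one ∈ cond S.
Hypothesis one_max : forall p, p ∈ cond S -> ⟨p, one⟩ ∈ ord S.

Local Notation "p ≼ q" := (⟨p, q⟩ ∈ ord S) (at level 70).

Lemma V_cond : V (cond S). Proof. apply hS. Qed.
Lemma V_ord : V (ord S). Proof. apply hS. Qed.
Lemma V_grp : V (grp S). Proof. apply hS. Qed.
Lemma V_filt : V (filt S). Proof. apply hS. Qed.
Lemma V_one : V one. Proof. exact (V_elt V_cond one_cond). Qed.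
Local Hint Resolve V_cond V_ord V_grp V_filt V_one : model.

Lemma le_cond p q : p ≼ q -> p ∈ cond S /\ q ∈ cond S.
Proof.
intros H; destruct (forcing_rel (sys_forcing hS) H) as [q' [p' [Hq [Hp E]]]].
destruct (opair_inj E); now subst.
Qed.

Lemma le_refl p : p ∈ cond S -> p ≼ p.
Proof. apply (sys_forcing hS). Qed.

Lemma le_trans p q r : p ≼ q -> q ≼ r -> p ≼ r.
Proof. exact (@forcing_trans _ _ (sys_forcing hS) r q p). Qed.

Lemma grp_aut f : f ∈ grp S -> automorphism (cond S) (ord S) f.
Proof. apply (sys_group hS). Qed.

Lemma filt_grp K f : K ∈ filt S -> f ∈ K -> f ∈ grp S.
Proof. intros HK; apply (sys_subgroup hS HK). Qed.

Section Automorphism.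
Variable f : zset.
Hypothesis Hf : automorphism (cond S) (ord S) f.

Lemma aut_cond p : p ∈ cond S -> app f p ∈ cond S.
Proof. apply (proj1 (proj1 Hf)). Qed.

Lemma aut_le p q : q ≼ p -> app f q ≼ app f p.
Proof. intros H; destruct (le_cond H) as [Hq Hp]; exact (proj1 (proj2 Hf p q Hp Hq) H). Qed.

Lemma aut_surj p : p ∈ cond S -> exists q, q ∈ cond S /\ app f q = p.
Proof. exact (proj2 (proj2 (proj1 Hf)) p). Qed.

Lemma aut_le_inv p q : p ∈ cond S -> q ≼ app f p ->
  exists q', q' ≼ p /\ app f q' = q.
Proof.
intros Hp Hq; destruct (aut_surj (proj1 (le_cond Hq))) as [q' [Hq' <-]].
exists q'; split; [exact (proj2 (proj2 Hf p q' Hp Hq') Hq) | reflexivity].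
Qed.

Lemma aut_one : app f one = one.
Proof.
apply (forcing_antisym (sys_forcing hS)).
- destruct (aut_surj one_cond) as [q [Hq E]]; rewrite <- E at 1.
  now apply aut_le, one_max.
- now apply one_max, aut_cond.
Qed.

Lemma aut_fdom : fdom f = cond S. Proof. exact (proj1 (proj2 (proj1 (proj1 Hf)))). Qed.

Lemma app_invfun p : p ∈ cond S -> app (invfun f) (app f p) = p.
Proof.
intros Hp; apply app_eq.
- split.
  + intros w Hw; apply mem_image in Hw; destruct Hw as [x [_ <-]]; eauto.
  + intros x y y' H K; apply mem_image in H; apply mem_image in K.
    destruct H as [z [Hz E]]; destruct K as [z' [Hz' E']].
    destruct (opair_inj E) as [E1 <-]; destruct (opair_inj E') as [E1' <-].
    rewrite aut_fdom in Hz, Hz'; apply (proj1 (proj2 (proj1 Hf))); congruence.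
- apply mem_image; exists p; rewrite aut_fdom; auto.
Qed.

End Automorphism.

Lemma is_name_entry p y x : is_name (cond S) x -> ⟨p, y⟩ ∈ x ->
  p ∈ cond S /\ is_name (cond S) y.
Proof.
intros H Hy; inversion H as [x' K]; subst.
destruct (K _ Hy) as [p' [y' [E [Hp Hn]]]]; destruct (opair_inj E); now subst.
Qed.

(** Only the values at conditions matter, so that [h] can be a composition or the
    identity, however it is coded as a set. *)
Lemma act_act f g h x : is_name (cond S) x ->
  (forall p, p ∈ cond S -> app h p = app f (app g p)) -> act f (act g x) = act h x.
Proof.
intros H E; induction (tmem_wf x) as [x _ IH]; apply zset_ext; intros w.
assert (IH' : forall p y, ⟨p, y⟩ ∈ x -> act f (act g y) = act h y).
{ intros p y Hy; apply IH; [apply subname_tmem; now exists p|].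
  apply (is_name_entry H Hy). }
rewrite !mem_act; split.
- intros [p' [y' [Hy ->]]]; apply mem_act in Hy; destruct Hy as [p [y [Hy E']]].
  destruct (opair_inj E'); subst; exists p, y; split; [exact Hy|].
  now rewrite E, (IH' p y Hy) by apply (is_name_entry H Hy).
- intros [p [y [Hy ->]]]; exists (app g p), (act g y); rewrite mem_act.
  split; [eauto|]; now rewrite E, (IH' p y Hy) by apply (is_name_entry H Hy).
Qed.

Lemma act_fix f x : is_name (cond S) x ->
  (forall p, p ∈ cond S -> app f p = p) -> act f x = x.
Proof.
intros H E; induction (tmem_wf x) as [x _ IH]; apply zset_ext; intros w.
assert (IH' : forall p y, ⟨p, y⟩ ∈ x -> act f y = y).
{ intros p y Hy; apply IH; [apply subname_tmem; now exists p|].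
  apply (is_name_entry H Hy). }
rewrite mem_act; split.
- intros [p [y [Hy ->]]]; now rewrite E, (IH' p y Hy) by apply (is_name_entry H Hy).
- intros Hw; inversion H as [x' K]; subst; destruct (K w Hw) as [p [y [-> [Hp _]]]].
  exists p, y; split; [exact Hw|]; now rewrite E, (IH' p y Hw).
Qed.

Lemma act_invfun f x : automorphism (cond S) (ord S) f -> is_name (cond S) x ->
  act (invfun f) (act f x) = x.
Proof.
intros Hf Hx; rewrite (act_act (h := idfun (cond S)) Hx).
- apply act_fix; [exact Hx|]; intros p Hp; exact (app_graph (fun p => p) Hp).
- intros p Hp; rewrite (app_invfun Hf Hp); exact (app_graph (fun p => p) Hp).
Qed.

Lemma mem_sym f x : f ∈ sym S x <-> f ∈ grp S /\ act f x = x.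
Proof. exact (mem_sep (grp S) (fun f => act f x = x) f). Qed.

Lemma V_sym x : V x -> V (sym S x).
Proof.
intros Hx; apply V_sep; [apply hS|]; apply definable_eq; [|definability].
apply definable_act; definability.
Qed.

Lemma sym_subgroup x : is_name (cond S) x -> subgroup_of S (sym S x).
Proof.
intros Hx; split; [intros f Hf; now apply mem_sym in Hf|].
pose proof (sys_group hS) as [G1 [G2 [G3 G4]]]; split; [|split; [|split]].
- intros f Hf; apply mem_sym in Hf; now apply G1.
- apply mem_sym; split; [exact G2|]; apply act_fix; [exact Hx|].
  intros p Hp; exact (app_graph (fun p => p) Hp).
- intros f g Hf Hg; apply mem_sym in Hf; apply mem_sym in Hg; apply mem_sym.
  destruct Hf as [Hf Ef], Hg as [Hg Eg]; split; [now apply G3|].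
  rewrite <- Ef, <- Eg at 2; symmetry; apply act_act; [exact Hx|]; intros p Hp.
  apply (app_graph (fun x => app f (app g x))); now rewrite (aut_fdom (grp_aut Hg)).
- intros f Hf; apply mem_sym in Hf; apply mem_sym; destruct Hf as [Hf Ef].
  split; [now apply G4|]; rewrite <- Ef at 1; apply act_invfun; [now apply G1 | exact Hx].
Qed.

(** Inclusion is enough here because a group in the filter contains inverses. *)
Lemma sym_filt x K : V x -> is_name (cond S) x -> K ∈ filt S ->
  (forall f p y, f ∈ K -> ⟨p, y⟩ ∈ x -> ⟨app f p, act f y⟩ ∈ x) -> sym S x ∈ filt S.
Proof.
intros Vx Hx HK H.
apply (sys_up hS (H := K)); [now apply V_sym | exact HK | now apply sym_subgroup|].
destruct (sys_subgroup hS HK) as [KG [K1 [_ [_ K4]]]].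
intros f Hf; apply mem_sym; split; [now apply KG|].
assert (Sub : forall g, g ∈ K -> act g x ⊆ x).
{ intros g Hg w Hw; apply mem_act in Hw; destruct Hw as [p [y [Hy ->]]]; auto. }
apply zset_ext; intros w; split; [now apply Sub|]; intros Hw.
inversion Hx as [x' L]; subst; destruct (L w Hw) as [p [y [-> [Hp Hy]]]].
pose proof (H _ _ _ (K4 f Hf) Hw) as Hw'.
assert (E : forall q, q ∈ cond S -> app f (app (invfun f) q) = q).
{ intros q Hq; destruct (aut_surj (K1 f Hf) Hq) as [r [Hr <-]].
  now rewrite (app_invfun (K1 f Hf) Hr). }
apply mem_act; exists (app (invfun f) p), (act (invfun f) y); split; [exact Hw'|].
rewrite (E p Hp); f_equal; rewrite (act_act (h := idfun (cond S)) Hy).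
- symmetry; apply act_fix; [exact Hy|]; intros q Hq; exact (app_graph (fun p => p) Hq).
- intros q Hq; rewrite (E q Hq); exact (app_graph (fun p => p) Hq).
Qed.

Lemma sname_V x : symmetric_name V S x -> V x.
Proof. now intros []. Qed.
Lemma sname_name x : symmetric_name V S x -> is_name (cond S) x.
Proof. now intros []. Qed.
Lemma sname_sym x : symmetric_name V S x -> sym S x ∈ filt S.
Proof. now intros []. Qed.
Lemma sname_entry x p y : symmetric_name V S x -> ⟨p, y⟩ ∈ x -> symmetric_name V S y.
Proof. intros [x' _ _ _ H]; apply H. Qed.

Lemma V_check x : V x -> V (check one x).
Proof.
intros Hx; apply V_term, definable_check; apply definable_const; auto with model.
Qed.

Lemma check_entry x p y : ⟨p, y⟩ ∈ check one x -> p = one /\ exists z, z ∈ x /\ y = check one z.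
Proof.
intros H; apply mem_check in H; destruct H as [z [Hz E]]; destruct (opair_inj E); eauto.
Qed.

Lemma is_name_check x : is_name (cond S) (check one x).
Proof.
induction (mem_wf x) as [x _ IH]; constructor; intros w Hw.
apply mem_check in Hw; destruct Hw as [y [Hy ->]]; exists one, (check one y); auto.
Qed.

Lemma act_check f x : f ∈ grp S -> act f (check one x) = check one x.
Proof.
intros Hf; induction (mem_wf x) as [x _ IH]; apply zset_ext; intros w.
rewrite mem_act; split.
- intros [p [y [Hy ->]]]; destruct (check_entry Hy) as [-> [z [Hz ->]]].
  rewrite (aut_one (grp_aut Hf)), (IH z Hz); apply mem_check; eauto.
- intros Hw; apply mem_check in Hw; destruct Hw as [z [Hz ->]].
  exists one, (check one z); split; [apply mem_check; eauto|].
  now rewrite (aut_one (grp_aut Hf)), (IH z Hz).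
Qed.

Lemma sname_check x : V x -> symmetric_name V S (check one x).
Proof.
induction (mem_wf x) as [x _ IH]; intros Hx; constructor.
- now apply V_check.
- apply is_name_check.
- apply sym_filt with (grp S); [now apply V_check | apply is_name_check | apply hS|].
  intros f p y Hf Hy; destruct (check_entry Hy) as [-> [z [Hz ->]]].
  rewrite (aut_one (grp_aut Hf)), (act_check z Hf); apply mem_check; eauto.
- intros p y Hy; destruct (check_entry Hy) as [-> [z [Hz ->]]].
  apply IH; [exact Hz | exact (V_elt Hx Hz)].
Qed.

(** Names for unordered and ordered pairs. *)
Definition upn (x y : zset) : zset := upair ⟨one, x⟩ ⟨one, y⟩.
Definition opn (x y : zset) : zset := upn (upn x x) (upn x y).

Lemma upn_entry x y p z : ⟨p, z⟩ ∈ upn x y -> p = one /\ (z = x \/ z = y).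
Proof.
intros H; apply mem_upair in H; destruct H as [E | E]; destruct (opair_inj E); auto.
Qed.

Lemma act_upn f x y : f ∈ grp S -> act f (upn x y) = upn (act f x) (act f y).
Proof.
intros Hf; apply zset_ext; intros w; rewrite mem_act; unfold upn at 2; rewrite mem_upair.
split.
- intros [p [z [Hz ->]]]; destruct (upn_entry Hz) as [-> [-> | ->]];
    rewrite (aut_one (grp_aut Hf)); auto.
- unfold upn; intros [-> | ->]; [exists one, x | exists one, y];
    rewrite mem_upair, (aut_one (grp_aut Hf)); auto.
Qed.

Lemma act_opn f x y : f ∈ grp S -> act f (opn x y) = opn (act f x) (act f y).
Proof. intros Hf; unfold opn; now rewrite !act_upn. Qed.

Lemma is_name_upn x y : is_name (cond S) x -> is_name (cond S) y ->
  is_name (cond S) (upn x y).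
Proof.
intros Hx Hy; constructor; intros w Hw; apply mem_upair in Hw.
destruct Hw as [-> | ->]; eauto.
Qed.

Lemma sname_upn x y : symmetric_name V S x -> symmetric_name V S y ->
  symmetric_name V S (upn x y).
Proof.
intros Hx Hy.
assert (Vu : V (upn x y)).
{ unfold upn; pose proof (sname_V Hx); pose proof (sname_V Hy); auto with model. }
assert (Hn : is_name (cond S) (upn x y)) by (apply is_name_upn; now apply sname_name).
constructor; auto.
- apply sym_filt with (inter (sym S x) (sym S y)); auto.
  + apply hS; now apply sname_sym.
  + intros f p z Hf Hz; apply mem_inter in Hf; rewrite !mem_sym in Hf.
    destruct Hf as [[Hf Ex] [_ Ey]], (upn_entry Hz) as [-> [-> | ->]];
      now rewrite (aut_one (grp_aut Hf)), ?Ex, ?Ey.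
- intros p z Hz; destruct (upn_entry Hz) as [-> [-> | ->]]; auto.
Qed.

Lemma sname_opn x y : symmetric_name V S x -> symmetric_name V S y ->
  symmetric_name V S (opn x y).
Proof. intros Hx Hy; unfold opn; now repeat apply sname_upn. Qed.

Ltac definable_name := lazymatch goal with
  | |- definable_term _ (fun e => act _ _) => apply definable_act
  | |- definable_term _ (fun e => sym S _) => unfold sym
  | |- definable_term _ (fun e => check _ _) => apply definable_check
  | |- definable_term _ (fun e => opn _ _) => unfold opn, upn
  end.

Ltac definable_known ::= first [definable_set | definable_name].

(** * Forcing equality and membership *)

(** The back condition is the forth condition for the pair of names in the opposite
    order; hence the required symmetry. *)
Definition forced_bisim (B : zset) : Prop :=
  forall p u, ⟨p, u⟩ ∈ B -> p ∈ cond S /\ ⟨p, ⟨zsnd u, zfst u⟩⟩ ∈ B /\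
    forall s z, ⟨s, z⟩ ∈ zfst u -> forall q, q ∈ cond S -> q ≼ p -> q ≼ s ->
      exists t w, ⟨t, w⟩ ∈ zsnd u /\
        exists r, r ∈ cond S /\ r ≼ q /\ r ≼ t /\ ⟨r, ⟨z, w⟩⟩ ∈ B.

(** Forced equality.  A quantification over the bisimulations in [V] replaces the
    customary recursion on pairs of names. *)
Definition feq (p x y : zset) : Prop :=
  exists B, V B /\ forced_bisim B /\ ⟨p, ⟨x, y⟩⟩ ∈ B.

(** A condition with this property forces [z] to be an element of [y]; the
    conditions forcing that are those below which this property is dense. *)
Definition fmem (p z y : zset) : Prop :=
  exists t w, ⟨t, w⟩ ∈ y /\ p ≼ t /\ feq p z w.

Lemma definable_feq n a b c : definable_term n a -> definable_term n b ->
  definable_term n c -> definable n (fun e => feq (a e) (b e) (c e)).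
Proof. intros Ha Hb Hc; unfold feq, forced_bisim; definability. Qed.

Lemma definable_fmem n a b c : definable_term n a -> definable_term n b ->
  definable_term n c -> definable n (fun e => fmem (a e) (b e) (c e)).
Proof.
intros Ha Hb Hc; unfold fmem; definability; apply definable_feq; definability.
Qed.

Ltac definable_forcing := lazymatch goal with
  | |- definable _ (fun e => feq _ _ _) => apply definable_feq
  | |- definable _ (fun e => fmem _ _ _) => apply definable_fmem
  end.

Ltac definable_known ::= first [definable_set | definable_name | definable_forcing].

Lemma feq_cond p x y : feq p x y -> p ∈ cond S.
Proof. intros [B [_ [HB H]]]; apply (HB _ _ H). Qed.

Lemma feq_sym p x y : feq p x y -> feq p y x.
Proof.
intros [B [VB [HB H]]]; exists B; split; [exact VB | split; [exact HB|]].
destruct (HB _ _ H) as [_ [K _]]; now rewrite zfst_pair, zsnd_pair in K.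
Qed.

Lemma feq_forth p x y s z q : feq p x y -> ⟨s, z⟩ ∈ x -> q ≼ p -> q ≼ s ->
  exists r, r ≼ q /\ fmem r z y.
Proof.
intros [B [VB [HB H]]] Hz Hp Hs; destruct (HB _ _ H) as [_ [_ K]].
rewrite zfst_pair, zsnd_pair in K.
destruct (K s z Hz q (proj1 (le_cond Hp)) Hp Hs) as [t [w [Hw [r [_ [Hr [Ht HrB]]]]]]].
exists r; split; [exact Hr|]; exists t, w; split; [exact Hw|]; split; [exact Ht|].
now exists B.
Qed.

(** The union of the bisimulations, cut down to the names in a transitive set
    containing [x] and [y], is a set of [V]; adjoining the two new triples to it
    gives the required bisimulation. *)
Lemma feq_intro p x y : V x -> V y -> p ∈ cond S ->
  (forall s z q, ⟨s, z⟩ ∈ x -> q ≼ p -> q ≼ s -> exists r, r ≼ q /\ fmem r z y) ->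
  (forall s z q, ⟨s, z⟩ ∈ y -> q ≼ p -> q ≼ s -> exists r, r ≼ q /\ fmem r z x) ->
  feq p x y.
Proof.
intros Vx Vy Hp Hxy Hyx; set (T := tcl (upair x y)).
assert (VT : V T) by (apply V_tcl; auto with model).
assert (HT : forall a s z, a ∈ T -> ⟨s, z⟩ ∈ a -> z ∈ T).
{ intros a s z Ha Hz; apply (transitive_set_tmem (tcl_transitive (x := _)) Ha).
  apply subname_tmem; now exists s. }
set (B := sep (prod (cond S) (prod T T)) (fun c =>
  feq (zfst c) (zfst (zsnd c)) (zsnd (zsnd c)) \/
  (zfst c = p /\ (zsnd c = ⟨x, y⟩ \/ zsnd c = ⟨y, x⟩)))).
assert (VB : V B).
{ apply V_sep; [apply V_prod; [|apply V_prod]; auto with model|].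
  pose proof (V_elt V_cond Hp); definability. }
assert (HB : forall q a b, ⟨q, ⟨a, b⟩⟩ ∈ B <-> (q ∈ cond S /\ a ∈ T /\ b ∈ T) /\
  (feq q a b \/ (q = p /\ (⟨a, b⟩ = ⟨x, y⟩ \/ ⟨a, b⟩ = ⟨y, x⟩)))).
{ intros q a b; unfold B; rewrite mem_sep, !mem_prod_pair, zfst_pair, !zsnd_pair, zfst_pair.
  tauto. }
assert (Tx : x ∈ T) by (apply mem_tcl, t_step, mem_upair; auto).
assert (Ty : y ∈ T) by (apply mem_tcl, t_step, mem_upair; auto).
exists B; split; [exact VB|]; split; [|apply HB; auto].
intros q u Hu.
assert (E : exists a b, u = ⟨a, b⟩).
{ apply mem_sep in Hu; destruct Hu as [Hu _]; apply mem_prod_pair in Hu.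
  destruct Hu as [_ Hu]; apply mem_prod in Hu; destruct Hu as [a [b [_ [_ ->]]]]; eauto. }
destruct E as [a [b ->]]; rewrite zfst_pair, zsnd_pair; apply HB in Hu.
destruct Hu as [[Hq [Ha Hb]] Hu]; split; [exact Hq|]; split.
- apply HB; split; [auto|]; destruct Hu as [Hu | [-> [E | E]]].
  + left; now apply feq_sym.
  + right; destruct (opair_inj E); subst; auto.
  + right; destruct (opair_inj E); subst; auto.
- assert (K : forall s z q', ⟨s, z⟩ ∈ a -> q' ≼ q -> q' ≼ s ->
    exists r, r ≼ q' /\ fmem r z b).
  { destruct Hu as [Hu | [-> [E | E]]].
    - intros s z q' Hz Hq' Hs; exact (feq_forth Hu Hz Hq' Hs).
    - destruct (opair_inj E); subst; exact Hxy.
    - destruct (opair_inj E); subst; exact Hyx. }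
  intros s z Hz q' _ Hq' Hs; destruct (K s z q' Hz Hq' Hs) as [r [Hr [t [w [Hw [Ht Hf]]]]]].
  exists t, w; split; [exact Hw|]; exists r; pose proof (feq_cond Hf) as Hrc.
  repeat split; auto; apply HB; split; [|now left]; split; [exact Hrc|].
  split; [exact (HT a s z Ha Hz) | exact (HT b t w Hb Hw)].
Qed.

Lemma feq_V p x y : feq p x y -> V x /\ V y.
Proof.
intros [B [VB [_ H]]]; exact (V_components (proj2 (V_pair_elt VB H))).
Qed.

Lemma feq_open p q x y : feq p x y -> q ≼ p -> feq q x y.
Proof.
intros H Hq; destruct (feq_V H) as [Vx Vy].
apply feq_intro; auto; [apply (le_cond Hq)|..]; intros s z r Hz Hr Hs.
- exact (feq_forth H Hz (le_trans Hr Hq) Hs).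
- exact (feq_forth (feq_sym H) Hz (le_trans Hr Hq) Hs).
Qed.

Lemma fmem_open p q z y : fmem p z y -> q ≼ p -> fmem q z y.
Proof.
intros [t [w [Hw [Ht H]]]] Hq; exists t, w; split; [exact Hw|].
split; [exact (le_trans Hq Ht) | exact (feq_open H Hq)].
Qed.

Lemma V_act f x : V f -> V x -> V (act f x).
Proof. intros Hf Hx; apply V_term, definable_act; now apply definable_const. Qed.

(** By induction on names rather than by moving a bisimulation: automorphisms reflect
    the order on conditions only, and a bisimulation may contain sets that are not
    names. *)
Lemma feq_act f p x y : f ∈ grp S -> is_name (cond S) x -> is_name (cond S) y ->
  feq p x y -> feq (app f p) (act f x) (act f y).
Proof.
intros Hf; revert p y; induction (tmem_wf x) as [x _ IH]; intros p y Hx Hy H.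
pose proof (grp_aut Hf) as Af; pose proof (V_elt V_grp Hf) as Vf.
destruct (feq_V H) as [Vx Vy]; pose proof (feq_cond H) as Hp.
apply feq_intro; try (now apply V_act); [now apply aut_cond| |];
  intros s' z' q' Hz' Hq' Hs'; apply mem_act in Hz'; destruct Hz' as [s [z [Hz E]]];
  destruct (opair_inj E) as [-> ->]; destruct (aut_le_inv Af Hp Hq') as [q [Hq <-]].
- destruct (is_name_entry Hx Hz) as [Hs Nz].
  apply (proj2 Af s q Hs (proj1 (le_cond Hq))) in Hs'.
  destruct (feq_forth H Hz Hq Hs') as [r [Hr [t [w [Hw [Ht K]]]]]].
  exists (app f r); split; [now apply aut_le|]; exists (app f t), (act f w).
  split; [apply mem_act; eauto|]; split; [now apply aut_le|].
  apply IH; auto; [apply subname_tmem; now exists s | apply (is_name_entry Hy Hw)].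
- destruct (is_name_entry Hy Hz) as [Hs Nz].
  apply (proj2 Af s q Hs (proj1 (le_cond Hq))) in Hs'.
  destruct (feq_forth (feq_sym H) Hz Hq Hs') as [r [Hr [t [w [Hw [Ht K]]]]]].
  exists (app f r); split; [now apply aut_le|]; exists (app f t), (act f w).
  split; [apply mem_act; eauto|]; split; [now apply aut_le|].
  apply feq_sym, IH; auto; [apply subname_tmem; now exists t | apply (is_name_entry Hx Hw)|].
  now apply feq_sym.
Qed.

Lemma fmem_act f p z y : f ∈ grp S -> is_name (cond S) z -> is_name (cond S) y ->
  fmem p z y -> fmem (app f p) (act f z) (act f y).
Proof.
intros Hf Hz Hy [t [w [Hw [Ht H]]]]; exists (app f t), (act f w).
split; [apply mem_act; eauto|]; split; [apply aut_le; [now apply grp_aut | exact Ht]|].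
apply feq_act; auto; apply (is_name_entry Hy Hw).
Qed.

Variable G : zset.
Hypothesis hG : generic V S G.

Lemma gen_cond p : p ∈ G -> p ∈ cond S.
Proof. apply hG. Qed.

Lemma gen_one : one ∈ G.
Proof.
destruct (generic_nonempty hG) as [p Hp].
exact (generic_up hG Hp (one_max (gen_cond Hp))).
Qed.

(** The members of [A] and the conditions with no extension in [A] together form a
    dense set. *)
Lemma generic_decides A : V A ->
  (exists p, p ∈ G /\ p ∈ A) \/ exists p, p ∈ G /\ forall q, q ≼ p -> q ∉ A.
Proof.
intros HA; set (D := sep (cond S) (fun p => p ∈ A \/ forall q, q ∈ cond S -> q ≼ p -> q ∉ A)).
assert (VD : V D).
{ apply V_sep; [apply V_cond|]; definability. }
destruct (generic_meets hG VD) as [p [Hp HpG]].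
- split; [intros p Hp; now apply mem_sep in Hp|].
  intros p Hp; destruct (classic (exists q, q ≼ p /\ q ∈ A)) as [[q [Hq HqA]]|N].
  + exists q; split; [|exact Hq]; apply mem_sep; split; [apply (le_cond Hq) | auto].
  + exists p; split; [|now apply le_refl]; apply mem_sep; split; [exact Hp|].
    right; intros q _ Hq HqA; apply N; eauto.
- apply mem_sep in Hp; destruct Hp as [_ [Hp | Hp]]; [left; eauto|].
  right; exists p; split; [exact HpG|]; intros q Hq; apply Hp; [apply (le_cond Hq) | exact Hq].
Qed.

Lemma gen_dir3 p q s : p ∈ G -> q ∈ G -> s ∈ G ->
  exists r, r ∈ G /\ r ≼ p /\ r ≼ q /\ r ≼ s.
Proof.
intros Hp Hq Hs; destruct (generic_dir hG Hp Hq) as [r [Hr [Hrp Hrq]]].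
destruct (generic_dir hG Hr Hs) as [u [Hu [Hur Hus]]].
exists u; repeat split; eauto using le_trans.
Qed.

Lemma generic_dense_below A p : V A -> p ∈ G ->
  (forall q, q ≼ p -> exists r, r ≼ q /\ r ∈ A) -> exists r, r ∈ G /\ r ∈ A.
Proof.
intros HA Hp H; destruct (generic_decides HA) as [K | [q [Hq K]]]; [exact K|].
destruct (generic_dir hG Hp Hq) as [q' [_ [Hp' Hq']]].
destruct (H q' Hp') as [r [Hr HrA]]; destruct (K r (le_trans Hr Hq') HrA).
Qed.

(** By induction on [x]: for an entry [⟨s, z⟩] of one name with [s] in [G], genericity
    turns the forth condition into a matching entry of the other name. *)
Lemma feq_sound p x y : p ∈ G -> feq p x y -> val G x = val G y.
Proof.
intros Hp; revert p y Hp; induction (tmem_wf x) as [x _ IH]; intros p y Hp H.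
destruct (feq_V H) as [Vx Vy].
assert (K : forall a b, feq p a b -> forall s z, s ∈ G -> ⟨s, z⟩ ∈ a ->
  exists r, r ∈ G /\ fmem r z b).
{ intros a b Hab s z Hs Hz; destruct (feq_V Hab) as [Va Vb].
  destruct (generic_dir hG Hp Hs) as [q [Hq [Hqp Hqs]]].
  destruct (@generic_dense_below (sep (cond S) (fun r => fmem r z b)) q) as [r [Hr K]].
  - apply V_sep; [apply V_cond|]; pose proof (proj2 (V_pair_elt Va Hz)).
    definability.
  - exact Hq.
  - intros q' Hq'; destruct (feq_forth Hab Hz (le_trans Hq' Hqp) (le_trans Hq' Hqs))
      as [r [Hr K]].
    exists r; split; [exact Hr|]; apply mem_sep; split; [apply (le_cond Hr) | exact K].
  - apply mem_sep in K; exists r; tauto. }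
apply zset_ext; intros u; rewrite !mem_val; split; intros [s [z [Hs [Hz ->]]]].
- destruct (K x y H s z Hs Hz) as [r [Hr [t [w [Hw [Ht Hf]]]]]].
  exists t, w; split; [exact (generic_up hG Hr Ht)|]; split; [exact Hw|].
  apply (IH z (subname_tmem (ex_intro _ s Hz)) r w Hr Hf).
- destruct (K y x (feq_sym H) s z Hs Hz) as [r [Hr [t [w [Hw [Ht Hf]]]]]].
  exists t, w; split; [exact (generic_up hG Hr Ht)|]; split; [exact Hw|]; symmetry.
  apply (IH w (subname_tmem (ex_intro _ t Hw)) r z Hr (feq_sym Hf)).
Qed.

(** The conditions that keep an entry of one name out of the other name form a set of
    [V] that [G] misses, by induction and because the values agree.  So some condition
    in [G] has no extension of this kind, in either direction, which is what forced
    equality requires. *)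
Lemma feq_complete x y : V x -> V y -> val G x = val G y -> exists p, p ∈ G /\ feq p x y.
Proof.
revert y; induction (tmem_wf x) as [x _ IH]; intros y Vx Vy E.
assert (K : forall a b, V a -> V b ->
  (forall s z, s ∈ G -> ⟨s, z⟩ ∈ a -> exists r, r ∈ G /\ fmem r z b) ->
  exists p, p ∈ G /\ forall s z q, ⟨s, z⟩ ∈ a -> q ≼ p -> q ≼ s ->
    exists r, r ≼ q /\ fmem r z b).
{ intros a b Va Vb H.
  set (A := sep (cond S) (fun p => exists s z, ⟨s, z⟩ ∈ a /\ p ≼ s /\
    forall r, r ∈ cond S -> r ≼ p -> ~ fmem r z b)).
  assert (VA : V A).
  { apply V_sep; [apply V_cond|]; definability. }
  destruct (generic_decides VA) as [[p [Hp HA]] | [p [Hp HA]]].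
  - exfalso; apply mem_sep in HA; destruct HA as [_ [s [z [Hz [Hps N]]]]].
    destruct (H s z (generic_up hG Hp Hps) Hz) as [r [Hr Hf]].
    destruct (generic_dir hG Hp Hr) as [q [_ [Hqp Hqr]]].
    exact (N q (proj1 (le_cond Hqp)) Hqp (fmem_open Hf Hqr)).
  - exists p; split; [exact Hp|]; intros s z q Hz Hq Hs; apply NNPP; intros N.
    apply (HA q Hq), mem_sep; split; [apply (le_cond Hq)|]; exists s, z.
    split; [exact Hz|]; split; [exact Hs|]; intros r _ Hr Hf; apply N; eauto. }
destruct (K x y Vx Vy) as [p1 [Hp1 H1]].
{ intros s z Hs Hz; assert (Hv : val G z ∈ val G y) by (rewrite <- E; apply mem_val; eauto).
  apply mem_val in Hv; destruct Hv as [t [w [Ht [Hw Ev]]]].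
  destruct (IH z (subname_tmem (ex_intro _ s Hz)) w (proj2 (V_pair_elt Vx Hz))
    (proj2 (V_pair_elt Vy Hw)) Ev) as [r [Hr Hf]].
  destruct (generic_dir hG Hr Ht) as [q [Hq [Hqr Hqt]]]; exists q; split; [exact Hq|].
  exists t, w; split; [exact Hw|]; split; [exact Hqt | exact (feq_open Hf Hqr)]. }
destruct (K y x Vy Vx) as [p2 [Hp2 H2]].
{ intros s z Hs Hz; assert (Hv : val G z ∈ val G x) by (rewrite E; apply mem_val; eauto).
  apply mem_val in Hv; destruct Hv as [t [w [Ht [Hw Ev]]]].
  destruct (IH w (subname_tmem (ex_intro _ t Hw)) z (proj2 (V_pair_elt Vx Hw))
    (proj2 (V_pair_elt Vy Hz)) (eq_sym Ev)) as [r [Hr Hf]].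
  destruct (generic_dir hG Hr Ht) as [q [Hq [Hqr Hqt]]]; exists q; split; [exact Hq|].
  exists t, w; split; [exact Hw|]; split; [exact Hqt|]; exact (feq_open (feq_sym Hf) Hqr). }
destruct (generic_dir hG Hp1 Hp2) as [p [Hp [L1 L2]]]; exists p; split; [exact Hp|].
apply feq_intro; auto; [now apply gen_cond|..]; intros s z q Hz Hq Hs.
- exact (H1 s z q Hz (le_trans Hq L1) Hs).
- exact (H2 s z q Hz (le_trans Hq L2) Hs).
Qed.

Lemma fmem_truth z y : V z -> V y ->
  val G z ∈ val G y <-> exists p, p ∈ G /\ fmem p z y.
Proof.
intros Vz Vy; rewrite mem_val; split.
- intros [t [w [Ht [Hw E]]]].
  destruct (feq_complete Vz (proj2 (V_pair_elt Vy Hw)) E) as [r [Hr Hf]].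
  destruct (generic_dir hG Hr Ht) as [q [Hq [Hqr Hqt]]]; exists q; split; [exact Hq|].
  exists t, w; split; [exact Hw|]; split; [exact Hqt | exact (feq_open Hf Hqr)].
- intros [p [Hp [t [w [Hw [Ht Hf]]]]]]; exists t, w.
  split; [exact (generic_up hG Hp Ht)|]; split; [exact Hw | exact (feq_sound Hp Hf)].
Qed.

Lemma val_check x : val G (check one x) = x.
Proof.
induction (mem_wf x) as [x _ IH]; apply zset_ext; intros z; rewrite mem_val; split.
- intros [p [y [Hp [Hy ->]]]]; destruct (check_entry Hy) as [_ [u [Hu ->]]].
  now rewrite (IH u Hu).
- intros Hz; exists one, (check one z); split; [apply gen_one|].
  split; [apply mem_check; eauto | symmetry; now apply IH].
Qed.

Lemma val_upn x y : val G (upn x y) = upair (val G x) (val G y).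
Proof.
apply zset_ext; intros z; rewrite mem_val, mem_upair; split.
- intros [p [w [_ [Hw ->]]]]; destruct (upn_entry Hw) as [_ [-> | ->]]; auto.
- unfold upn; intros [-> | ->]; [exists one, x | exists one, y];
    rewrite mem_upair; auto using gen_one.
Qed.

Lemma val_opn x y : val G (opn x y) = ⟨val G x, val G y⟩.
Proof. unfold opn; now rewrite !val_upn. Qed.

Lemma extension_ground x : V x -> extension V S G x.
Proof.
intros Hx; exists (check one x); split; [now apply sname_check | now rewrite val_check].
Qed.

(** * Consequences of distributivity *)

Lemma V_graph f a : V a -> definable_term 1 (fun e => f (hd empty e)) -> V (graph f a).
Proof. intros Ha Hf; apply V_image; [exact Ha|]; definability. Qed.

Variable k : zset.
Hypothesis hk : V k.
Hypothesis hreg : regular_cardinal V k.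
Hypothesis hdist : desc_distributive V k S.

Lemma k_ordinal : ordinal k. Proof. apply hreg. Qed.

Lemma k_sub a : a ∈ k -> a ⊆ k. Proof. exact (proj1 k_ordinal a). Qed.

(** Since [G] meets each of the open sets, some [p] in [G] makes all of them dense
    below it.  Adding to each the conditions incompatible with [p] gives open dense
    sets, to which distributivity applies. *)
Lemma distributive_meet E : V E ->
  (forall a, a ∈ k -> app E a ⊆ cond S) ->
  (forall a p q, a ∈ k -> p ∈ app E a -> q ≼ p -> q ∈ app E a) ->
  (forall a b, b ∈ k -> a ∈ b -> app E b ⊆ app E a) ->
  (forall a, a ∈ k -> exists p, p ∈ G /\ p ∈ app E a) ->
  exists q, q ∈ G /\ forall a, a ∈ k -> q ∈ app E a.
Proof.
intros VE HP Hopen Hdec HG.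
set (A := sep (cond S) (fun p => exists a, a ∈ k /\
  forall q, q ∈ cond S -> q ≼ p -> q ∉ app E a)).
assert (VA : V A) by (apply V_sep; [apply V_cond|]; definability).
destruct (generic_decides VA) as [[p [Hp HA]] | [p [Hp HA]]].
{ exfalso; apply mem_sep in HA; destruct HA as [_ [a [Ha N]]].
  destruct (HG a Ha) as [d [Hd HdE]]; destruct (generic_dir hG Hp Hd) as [r [Hr [Hrp Hrd]]].
  exact (N r (gen_cond Hr) Hrp (Hopen a d r Ha HdE Hrd)). }
set (D := fun a => sep (cond S) (fun q => q ∈ app E a \/
  ~ exists r, r ∈ cond S /\ r ≼ q /\ r ≼ p)).
pose proof (V_elt V_cond (gen_cond Hp)) as Vp.
assert (VD : V (graph D k)) by (apply V_graph; [exact hk|]; unfold D; definability).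
assert (HD : forall a, a ∈ k -> open_dense (cond S) (ord S) (app (graph D k) a)).
{ intros a Ha; rewrite (app_graph D Ha); split; [split|].
  - intros q Hq; now apply mem_sep in Hq.
  - intros q Hq.
    destruct (classic (exists r, r ∈ cond S /\ r ≼ q /\ r ≼ p)) as [[r [Hr [Hrq Hrp]]]|N].
    + destruct (classic (exists r', r' ≼ r /\ r' ∈ app E a)) as [[r' [Hr' H]]|N].
      * exists r'; split; [|exact (le_trans Hr' Hrq)]; apply mem_sep; split; [|auto].
        apply (le_cond Hr').
      * exfalso; apply (HA r Hrp), mem_sep; split; [exact Hr|]; exists a.
        split; [exact Ha|]; intros r' _ Hr' H; apply N; eauto.
    + exists q; split; [apply mem_sep; auto | now apply le_refl].
  - intros q q' Hq Hq'; apply mem_sep in Hq; apply mem_sep.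
    split; [apply (le_cond Hq')|]; destruct Hq as [_ [Hq | N]]; [left; eauto|].
    right; intros [r [Hr [H1 H2]]]; apply N; exists r.
    split; [exact Hr|]; split; [exact (le_trans H1 Hq') | exact H2]. }
destruct (proj1 hdist (graph D k) VD (isfun_graph D k) (fdom_graph D k) HD) as [Hdense _].
{ intros a b Hb Ha q Hq; rewrite (app_graph D Hb) in Hq.
  rewrite (app_graph D (k_sub Hb Ha)); apply mem_sep in Hq; apply mem_sep.
  split; [apply Hq|]; destruct Hq as [_ [Hq | N]]; [left | now right].
  exact (Hdec a b Hb Ha q Hq). }
assert (VI : V (sep (cond S) (fun p => forall a, a ∈ k -> p ∈ app (graph D k) a))).
{ apply V_sep; [apply V_cond|]; definability. }
destruct (generic_meets hG VI Hdense) as [q [Hq HqG]]; exists q; split; [exact HqG|].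
intros a Ha; apply mem_sep in Hq; destruct Hq as [_ Hq]; specialize (Hq a Ha).
rewrite (app_graph D Ha) in Hq; apply mem_sep in Hq; destruct Hq as [_ [Hq | N]]; [exact Hq|].
destruct (generic_dir hG HqG Hp) as [r [Hr Hrr]]; destruct N; exists r.
split; [exact (gen_cond Hr) | exact Hrr].
Qed.

(** Otherwise the one-element function with value [b] would be cofinal in [k]. *)
Lemma k_limit b : b ∈ k -> exists c, c ∈ k /\ b ∈ c.
Proof.
intros Hb; apply NNPP; intros N.
destruct hreg as [Hk [Hom [_ Hcof]]].
assert (H1 : succ empty ∈ k) by (apply Hom, mem_collect; now exists 1).
assert (E0 : empty ∈ succ empty) by (apply mem_succ; auto).
assert (V1 : V (succ empty)) by exact (V_elt hk H1).
pose proof (V_elt hk Hb) as Vb.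
apply (Hcof (succ empty) (graph (fun _ => b) (succ empty)) H1).
- apply V_graph; [exact V1|]; definability.
- split; [apply isfun_graph|]; split; [apply fdom_graph|].
  intros x Hx; now rewrite (app_graph (fun _ => b) Hx).
- split.
  + intros x Hx; apply mem_image in Hx; destruct Hx as [y [Hy <-]].
    now rewrite (app_graph (fun _ => b) Hy).
  + intros c Hc; exists b; split.
    * apply mem_image; exists empty; split; [exact E0|].
      now rewrite (app_graph (fun _ => b) E0).
    * destruct (ordinal_trichotomy (ordinal_elt Hk Hb) (ordinal_elt Hk Hc))
        as [H | [-> | H]]; [destruct N; eauto | auto | auto].
Qed.

Lemma unbounded_next I b : unbounded I k -> b ∈ k -> exists c, next_in I b c.
Proof.
intros [HI Hun] Hb; apply next_in_exists with k; [apply k_ordinal | exact HI|].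
destruct (k_limit Hb) as [x [Hx Hbx]]; destruct (Hun x Hx) as [c [Hc [H | <-]]].
- exists c; split; [exact Hc|].
  exact (proj1 (ordinal_elt k_ordinal (HI c Hc)) x H b Hbx).
- eauto.
Qed.

Definition selects (f F a : zset) : Prop :=
  isfun f /\ fdom f = a /\ forall b, b ∈ a -> app f b ∈ app F b.

(** Using the least [c] above [b] makes the choice of the selector consulted at [b]
    definable. *)
Lemma selector_glue F I (h : zset -> zset) f : fdom F = k -> unbounded I k ->
  (forall c, c ∈ I -> selects (h c) F c) ->
  (forall w, w ∈ f -> exists b y, w = ⟨b, y⟩) ->
  (forall b y, ⟨b, y⟩ ∈ f <-> b ∈ k /\ exists c, next_in I b c /\ ⟨b, y⟩ ∈ h c) ->
  selector f F.
Proof.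
intros HF HI Hh Hf Hfe.
assert (K : forall b, b ∈ k -> exists c, (forall y, ⟨b, y⟩ ∈ f <-> y = app (h c) b) /\
  app (h c) b ∈ app F b).
{ intros b Hb; destruct (unbounded_next HI Hb) as [c Hc]; exists c.
  destruct (Hh c (proj1 Hc)) as [H1 [H2 H3]].
  assert (Hbc : b ∈ c) by apply Hc.
  split; [|auto]; intros y; rewrite Hfe, <- app_iff by (rewrite ?H2; auto); split.
  - intros [_ [d [Hd Hy]]]; now rewrite (next_in_unique Hc Hd).
  - intros Hy; split; [exact Hb|]; eauto. }
assert (Hif : isfun f).
{ split; [exact Hf|]; intros b y y' Hy Hy'; pose proof (proj1 (proj1 (Hfe b y) Hy)) as Hb.
  destruct (K b Hb) as [c [Hc _]]; apply Hc in Hy; apply Hc in Hy'; congruence. }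
split; [exact Hif|]; rewrite HF; split.
- apply zset_ext; intros b; rewrite mem_fdom; split.
  + intros [y Hy]; now apply Hfe in Hy.
  + intros Hb; destruct (K b Hb) as [c [Hc _]]; exists (app (h c) b); now apply Hc.
- intros b Hb; destruct (K b Hb) as [c [Hc Hv]].
  rewrite (app_eq Hif (proj2 (Hc _) eq_refl)); exact Hv.
Qed.

(** * From the extension to the ground model *)

Lemma selects_graph f F a b : transitive_set a -> b ∈ a -> selects f F a ->
  selects (graph (app f) b) F b.
Proof.
intros Ha Hb [H1 [H2 H3]]; split; [apply isfun_graph|]; split; [apply fdom_graph|].
intros c Hc; rewrite (app_graph _ Hc); apply H3; exact (Ha b Hb c Hc).
Qed.

(** The sets of selectors of [F ↾ a], for [a] in [k], form an approachable sequence.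
    A selector [g] of it in the extension need not be in [V], but some condition in [G]
    decides [g] at unboundedly many places, and the selectors found there glue. *)
Lemma EC_ground : EC (extension V S G) k -> EC V k.
Proof.
intros HEC F VF [HF [HdF [HneF HselF]]].
set (Y := ⋃ image (app F) k).
assert (VY : V Y).
{ apply V_bigcup, V_image; [exact hk|]; definability. }
destruct (V_power (V_prod hk VY)) as [Q [VQ HQ]].
set (Fs := fun a => sep Q (fun f => selects f F a)).
assert (VFs : V (graph Fs k)).
{ apply V_graph; [exact hk|]; unfold Fs, selects; definability. }
assert (mem_Fs : forall a f, a ∈ k -> (f ∈ Fs a <-> V f /\ selects f F a)).
{ intros a f Ha; unfold Fs; rewrite mem_sep, HQ; split; [tauto|].
  intros [Vf Hf]; split; [|exact Hf]; split; [exact Vf|]; intros w Hw.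
  destruct Hf as [H1 [H2 H3]]; destruct (proj1 H1 w Hw) as [b [y ->]].
  assert (Hb : b ∈ a) by (rewrite <- H2; apply mem_fdom; eauto).
  apply mem_prod_pair; split; [exact (k_sub Ha Hb)|]; apply mem_bigcup.
  exists (app F b); split; [apply mem_image; exists b; split; [exact (k_sub Ha Hb)|reflexivity]|].
  rewrite <- (app_eq H1 Hw); auto. }
assert (HFs : forall a, a ∈ k -> exists f, f ∈ Fs a).
{ intros a Ha; destruct (HselF a Ha) as [f [Vf Hf]]; exists f; apply mem_Fs; [exact Ha|].
  split; [exact Vf|]; apply (@selector_restr f F a HF); [|exact Hf].
  rewrite HdF; exact (k_sub Ha). }
destruct (HEC (graph Fs k)) as [g [[gn [Hgn Eg]] [Hg1 [Hg2 Hg3]]]].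
{ now apply extension_ground. }
{ split; [apply isfun_graph|]; split; [apply fdom_graph|]; split; intros b Hb.
  - rewrite (app_graph Fs Hb); intros E; destruct (HFs b Hb) as [f Hf]; rewrite E in Hf.
    exact (not_mem_empty Hf).
  - destruct (HFs b Hb) as [f Hf]; apply (mem_Fs b f Hb) in Hf; destruct Hf as [Vf Hf].
    pose proof (V_elt hk Hb) as Vb.
    exists (graph (fun a => graph (app f) a) b); split.
    + apply extension_ground, V_graph; [exact Vb|]; definability.
    + apply selector_restr; [apply isfun_graph | rewrite fdom_graph; exact (k_sub Hb)|].
      split; [apply isfun_graph|]; split; [apply fdom_graph|]; intros a Ha.
      pose proof (k_sub Hb Ha) as Hak; pose proof (V_elt hk Hak) as Va.
      rewrite (app_graph _ Ha), (app_graph Fs Hak); apply mem_Fs; [exact Hak|]; split.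
      * apply V_graph; [exact Va|]; definability.
      * apply selects_graph with b; auto; exact (proj1 (ordinal_elt k_ordinal Hb)). }
rewrite fdom_graph in Hg2, Hg3; pose proof (sname_V Hgn) as Vgn.
assert (Hg : forall b x, b ∈ k -> V x ->
  (x = app g b <-> exists q, q ∈ G /\ fmem q (check one ⟨b, x⟩) gn)).
{ intros b x Hb Vx; pose proof (V_elt hk Hb) as Vb.
  rewrite <- fmem_truth, val_check, <- Eg by (try apply V_check; auto with model).
  rewrite <- app_iff; [tauto | exact Hg1 | now rewrite Hg2]. }
assert (VFb : forall b x, b ∈ k -> x ∈ Fs b -> V x).
{ intros b x Hb Hx; now apply (mem_Fs b x Hb) in Hx. }
assert (Hgb : forall b, b ∈ k -> app g b ∈ Fs b).
{ intros b Hb; rewrite <- (app_graph Fs Hb); auto. }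
(* The conditions deciding [g] at some place from [a] on. *)
set (E := graph (fun a => sep (cond S) (fun q => exists b, b ∈ k /\ (a ∈ b \/ a = b) /\
  exists x, x ∈ app (graph Fs k) b /\ fmem q (check one ⟨b, x⟩) gn)) k).
assert (HE : forall a q, a ∈ k -> (q ∈ app E a <-> q ∈ cond S /\ exists b, b ∈ k /\
  (a ∈ b \/ a = b) /\ exists x, x ∈ Fs b /\ fmem q (check one ⟨b, x⟩) gn)).
{ intros a q Ha; unfold E; rewrite (app_graph _ Ha), mem_sep.
  split; intros [Hq [b [Hb [Hab [x Hx]]]]]; (split; [exact Hq|]); exists b;
    (split; [exact Hb|]); (split; [exact Hab|]); exists x; revert Hx;
    now rewrite (app_graph Fs Hb). }
destruct (@distributive_meet E) as [q [HqG Hq]].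
{ apply V_graph; [exact hk|]; definability. }
{ intros a Ha q Hq; now apply HE in Hq. }
{ intros a p q Ha Hp Hq; apply HE in Hp; [|exact Ha]; apply HE; [exact Ha|].
  destruct Hp as [_ [b [Hb [Hab [x [Hx Hf]]]]]]; split; [apply (le_cond Hq)|].
  exists b; split; [exact Hb|]; split; [exact Hab|]; exists x; split; [exact Hx|].
  exact (fmem_open Hf Hq). }
{ intros a a' Ha' Ha q Hq; apply HE in Hq; [|exact Ha'].
  apply HE; [exact (k_sub Ha' Ha)|]; destruct Hq as [Hq [b [Hb [Hab H]]]].
  split; [exact Hq|]; exists b; split; [exact Hb|]; split; [left|exact H].
  destruct Hab as [Hab | <-]; [|exact Ha].
  exact (proj1 (ordinal_elt k_ordinal Hb) a' Hab a Ha). }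
{ intros a Ha; pose proof (Hgb a Ha) as Hx.
  destruct (proj1 (Hg a (app g a) Ha (VFb a _ Ha Hx)) eq_refl) as [p [Hp Hf]].
  exists p; split; [exact Hp|]; apply HE; [exact Ha|]; split; [exact (gen_cond Hp)|].
  exists a; split; [exact Ha|]; split; [now right|]; eauto. }
pose proof (V_elt V_cond (gen_cond HqG)) as Vq.
set (I := sep k (fun b => exists x, x ∈ app (graph Fs k) b /\ fmem q (check one ⟨b, x⟩) gn)).
assert (VI : V I) by (apply V_sep; [exact hk|]; definability).
assert (HI : forall b, b ∈ I -> b ∈ k /\ fmem q (check one ⟨b, app g b⟩) gn).
{ intros b Hb; apply mem_sep in Hb; destruct Hb as [Hb [x [Hx Hf]]]; split; [exact Hb|].
  rewrite (app_graph Fs Hb) in Hx; enough (E' : x = app g b) by now rewrite <- E'.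
  apply Hg; [exact Hb | exact (VFb b x Hb Hx) | eauto]. }
assert (Hun : unbounded I k).
{ split; [intros b Hb; now apply HI|]; intros a Ha; specialize (Hq a Ha).
  apply HE in Hq; [|exact Ha]; destruct Hq as [_ [b [Hb [Hab H]]]].
  exists b; split; [|exact Hab]; apply mem_sep; split; [exact Hb|].
  now rewrite (app_graph Fs Hb). }
set (f := sep (prod k Y) (fun w => exists c, c ∈ I /\ next_in I (zfst w) c /\
  exists x, x ∈ app (graph Fs k) c /\ fmem q (check one ⟨c, x⟩) gn /\ w ∈ x)).
exists f; split.
{ apply V_sep; [now apply V_prod|]; definability. }
apply selector_glue with I (app g); auto.
- intros c Hc; destruct (HI c Hc) as [Hck _]; now apply (mem_Fs c _ Hck), Hgb.
- intros w Hw; apply mem_sep in Hw; destruct Hw as [Hw _]; apply mem_prod in Hw.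
  destruct Hw as [b [y [_ [_ ->]]]]; eauto.
- intros b y; unfold f; rewrite mem_sep, mem_prod_pair, zfst_pair; split.
  + intros [[Hb Hy] [c [Hc [Hn [x [Hx [Hf Hw]]]]]]]; split; [exact Hb|].
    exists c; split; [exact Hn|]; destruct (HI c Hc) as [Hck _].
    rewrite (app_graph Fs Hck) in Hx.
    replace (app g c) with x; [exact Hw|]; apply Hg; [exact Hck|exact (VFb c x Hck Hx)|eauto].
  + intros [Hb [c [Hn Hw]]]; assert (Hc : c ∈ I) by apply Hn.
    destruct (HI c Hc) as [Hck Hf]; pose proof (Hgb c Hck) as Hgc.
    destruct (proj1 (mem_sep _ _ _) Hgc) as [HgQ _]; apply HQ in HgQ.
    destruct HgQ as [_ Hsub]; pose proof (Hsub _ Hw) as Hby; apply mem_prod_pair in Hby.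
    split; [exact Hby|]; exists c; split; [exact Hc|]; split; [exact Hn|].
    exists (app g c); rewrite (app_graph Fs Hck); auto.
Qed.

(** * From the ground model to the extension *)

Section Lifting.
Variable Fn : zset.
Hypothesis hFn : symmetric_name V S Fn.

Let F := val G Fn.
Let T := tcl Fn.

Hypothesis HF : isfun F.
Hypothesis HdF : fdom F = k.

Lemma V_Fn : V Fn. Proof. exact (sname_V hFn). Qed.
Lemma V_T : V T. Proof. exact (V_tcl V_Fn). Qed.
Local Hint Resolve V_Fn V_T hk : model.

(** The name of an entry of a function: the argument is a set of the ground model, the
    value is given by a name. *)
Definition entry_at (b y : zset) : zset := opn (check one b) y.

(** [r] forces [y] to be an element of the value of [F] at [b].  The chain of entries
    leads from [Fn] to a pair of [F], to the unordered pair [{b, F(b)}] in it, to a name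
    [w] of [F(b)], and to [y]; it makes [y] symmetric, bounds the possible [y] by a set,
    and is preserved by the symmetries of [Fn]. *)
Definition forced_value (r b y : zset) : Prop :=
  exists s1 a, ⟨s1, a⟩ ∈ Fn /\ exists s2 u, ⟨s2, u⟩ ∈ a /\
  exists s3 w, ⟨s3, w⟩ ∈ u /\ exists s, s ∈ cond S /\ ⟨s, y⟩ ∈ w /\
  r ≼ s /\ fmem r (entry_at b w) Fn.

Lemma definable_forced_value n a b c : definable_term n a -> definable_term n b ->
  definable_term n c -> definable n (fun e => forced_value (a e) (b e) (c e)).
Proof. intros Ha Hb Hc; unfold forced_value, entry_at; definability. Qed.

Ltac definable_selector := lazymatch goal with
  | |- definable _ (fun e => forced_value _ _ _) => apply definable_forced_value
  | |- definable_term _ (fun e => entry_at _ _) => unfold entry_at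
  end.

Ltac definable_known ::=
  first [definable_set | definable_name | definable_forcing | definable_selector].

Lemma val_entry_at b y : val G (entry_at b y) = ⟨b, val G y⟩.
Proof. unfold entry_at; now rewrite val_opn, val_check. Qed.

Lemma V_entry_at b y : V b -> V y -> V (entry_at b y).
Proof.
intros Hb Hy; pose proof (V_check Hb); unfold entry_at, opn, upn; auto 10 with model.
Qed.

Lemma act_entry_at f b y : f ∈ grp S -> act f (entry_at b y) = entry_at b (act f y).
Proof. intros Hf; unfold entry_at; now rewrite act_opn, act_check. Qed.

Lemma sname_entry_at b y : V b -> symmetric_name V S y -> symmetric_name V S (entry_at b y).
Proof. intros Hb Hy; apply sname_opn; [now apply sname_check | exact Hy]. Qed.

Lemma forced_value_sname r b y : forced_value r b y -> symmetric_name V S y.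
Proof.
intros [s1 [a [Ha [s2 [u [Hu [s3 [w [Hw [s [_ [Hy _]]]]]]]]]]]].
eauto using sname_entry.
Qed.

Lemma forced_value_T r b y : forced_value r b y -> y ∈ T.
Proof.
intros [s1 [a [Ha [s2 [u [Hu [s3 [w [Hw [s [_ [Hy _]]]]]]]]]]]]; apply mem_tcl.
assert (K : forall s x z, ⟨s, x⟩ ∈ z -> tmem x z).
{ intros; apply subname_tmem; eexists; eassumption. }
eapply t_trans; [exact (K _ _ _ Hy)|]; eapply t_trans; [exact (K _ _ _ Hw)|].
eapply t_trans; [exact (K _ _ _ Hu) | exact (K _ _ _ Ha)].
Qed.

Lemma forced_value_open p q b y : forced_value p b y -> q ≼ p -> forced_value q b y.
Proof.
intros [s1 [a [Ha [s2 [u [Hu [s3 [w [Hw [s [Hs [Hy [Hp Hf]]]]]]]]]]]]] Hq.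
exists s1, a; split; [exact Ha|]; exists s2, u; split; [exact Hu|].
exists s3, w; split; [exact Hw|]; exists s; split; [exact Hs|]; split; [exact Hy|].
split; [exact (le_trans Hq Hp) | exact (fmem_open Hf Hq)].
Qed.

Lemma forced_value_sound r b y : b ∈ k -> r ∈ G -> forced_value r b y -> val G y ∈ app F b.
Proof.
intros Hb Hr [s1 [a [Ha [s2 [u [Hu [s3 [w [Hw [s [Hs [Hy [Hp Hf]]]]]]]]]]]]].
pose proof (V_elt hk Hb) as Vb.
assert (Vw : V w).
{ apply sname_V; eauto using sname_entry. }
assert (K : ⟨b, val G w⟩ ∈ F).
{ rewrite <- val_entry_at; apply fmem_truth; eauto using V_entry_at, V_Fn. }
rewrite (app_eq HF K); apply mem_val; exists s, y.
split; [exact (generic_up hG Hr Hp) | auto].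
Qed.

Lemma forced_value_complete b v : b ∈ k -> v ∈ app F b ->
  exists r y, r ∈ G /\ v = val G y /\ forced_value r b y.
Proof.
intros Hb Hv; pose proof (V_elt hk Hb) as Vb.
assert (K : ⟨b, app F b⟩ ∈ F) by (apply app_mem; [exact HF | now rewrite HdF]).
assert (Hname : forall x z, symmetric_name V S x -> z ∈ val G x ->
  exists s y, s ∈ G /\ ⟨s, y⟩ ∈ x /\ z = val G y /\ symmetric_name V S y).
{ intros x z Hx Hz; apply mem_val in Hz; destruct Hz as [s [y [Hs [Hy Ez]]]].
  exists s, y; eauto using sname_entry. }
destruct (Hname _ _ hFn K) as [s1 [a [_ [Ha [Ea Na]]]]].
destruct (Hname a (upair b (app F b)) Na) as [s2 [u [_ [Hu [Eu Nu]]]]].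
{ rewrite <- Ea; unfold opair; apply mem_upair; auto. }
destruct (Hname u (app F b) Nu) as [s3 [w [_ [Hw [Ew Nw]]]]].
{ rewrite <- Eu; apply mem_upair; auto. }
rewrite Ew in Hv; destruct (Hname w v Nw Hv) as [s [y [Hs [Hy [Ey Ny]]]]].
rewrite Ew, <- val_entry_at in K; apply fmem_truth in K;
  [|apply V_entry_at; [exact Vb | exact (sname_V Nw)] | exact V_Fn].
destruct K as [r0 [Hr0 Hf]]; destruct (generic_dir hG Hr0 Hs) as [r [Hr [H1 H2]]].
exists r, y; split; [exact Hr|]; split; [exact Ey|].
exists s1, a; split; [exact Ha|]; exists s2, u; split; [exact Hu|].
exists s3, w; split; [exact Hw|]; exists s; split; [exact (gen_cond Hs)|].
split; [exact Hy|]; split; [exact H2 | exact (fmem_open Hf H1)].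
Qed.

Lemma forced_value_act f r b y : f ∈ sym S Fn -> V b -> forced_value r b y ->
  forced_value (app f r) b (act f y).
Proof.
intros Hf Vb [s1 [a [Ha [s2 [u [Hu [s3 [w [Hw [s [Hs [Hy [Hr Hm]]]]]]]]]]]]].
apply mem_sym in Hf; destruct Hf as [Hf E]; pose proof (grp_aut Hf) as Af.
assert (Nw : symmetric_name V S w) by eauto using sname_entry.
exists (app f s1), (act f a); split; [rewrite <- E; apply mem_act; eauto|].
exists (app f s2), (act f u); split; [apply mem_act; eauto|].
exists (app f s3), (act f w); split; [apply mem_act; eauto|].
exists (app f s); split; [now apply aut_cond|]; split; [apply mem_act; eauto|].
split; [now apply aut_le|]; rewrite <- (act_entry_at b w Hf), <- E.
apply fmem_act; [exact Hf| |exact (sname_name hFn)|exact Hm].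
apply sname_name, sname_entry_at; auto.
Qed.

(** The shape of the names of selectors on [a].  Each entry is attached to a condition
    that forces its value to be right, so a condition forcing such a name to be a
    selector has to force single-valuedness and totality only. *)
Definition value_name (a g : zset) : Prop :=
  forall x, x ∈ g -> exists p, p ∈ cond S /\ exists b, b ∈ a /\ exists y, y ∈ T /\
    x = ⟨p, entry_at b y⟩ /\ forced_value p b y.

Definition forced_selector (q a g : zset) : Prop :=
  value_name a g /\
  (forall b, b ∈ a -> forall y, y ∈ T -> forall y', y' ∈ T ->
    forall p, p ∈ cond S -> forall p', p' ∈ cond S ->
    ⟨p, entry_at b y⟩ ∈ g -> ⟨p', entry_at b y'⟩ ∈ g ->
    forall r, r ∈ cond S -> r ≼ q -> r ≼ p -> r ≼ p' ->
    exists r', r' ∈ cond S /\ r' ≼ r /\ feq r' y y') /\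
  (forall b, b ∈ a -> forall q', q' ∈ cond S -> q' ≼ q ->
    exists r, r ∈ cond S /\ r ≼ q' /\ exists y, y ∈ T /\ exists p, p ∈ cond S /\
      ⟨p, entry_at b y⟩ ∈ g /\ r ≼ p /\ forced_value p b y).

Lemma definable_forced_selector n q a g : definable_term n q -> definable_term n a ->
  definable_term n g -> definable n (fun e => forced_selector (q e) (a e) (g e)).
Proof.
intros Hq Ha Hg; unfold forced_selector, value_name; definability.
Qed.

Lemma value_name_is_name a g : a ⊆ k -> value_name a g -> is_name (cond S) g.
Proof.
intros Ha Hg; constructor; intros x Hx.
destruct (Hg x Hx) as [p [Hp [b [Hb [y [_ [-> Hv]]]]]]].
exists p, (entry_at b y); split; [reflexivity|]; split; [exact Hp|].
apply sname_name, sname_entry_at; [exact (V_elt hk (Ha b Hb))|].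
exact (forced_value_sname Hv).
Qed.

Lemma value_name_sname a g : a ⊆ k -> V g -> value_name a g -> sym S g ∈ filt S ->
  symmetric_name V S g.
Proof.
intros Ha Vg Hg Hs; constructor; auto; [exact (value_name_is_name Ha Hg)|].
intros p y Hy; destruct (Hg _ Hy) as [p' [Hp [b [Hb [z [_ [E Hv]]]]]]].
destruct (opair_inj E) as [_ ->]; apply sname_entry_at; [exact (V_elt hk (Ha b Hb))|].
exact (forced_value_sname Hv).
Qed.

Lemma mem_val_value_name a g v : value_name a g -> v ∈ val G g ->
  exists p b y, p ∈ G /\ b ∈ a /\ y ∈ T /\ ⟨p, entry_at b y⟩ ∈ g /\ v = ⟨b, val G y⟩ /\
    forced_value p b y.
Proof.
intros Hg Hv; apply mem_val in Hv; destruct Hv as [p [x [Hp [Hx ->]]]].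
destruct (Hg _ Hx) as [p' [_ [b [Hb [y [Hy [E Hv]]]]]]].
destruct (opair_inj E); subst p' x; exists p, b, y.
rewrite val_entry_at; repeat split; auto.
Qed.

Lemma forced_selector_sound q a g : q ∈ G -> a ∈ k -> V g -> forced_selector q a g ->
  selects (val G g) F a.
Proof.
intros Hq Ha Vg [Hg [Hsv Htot]]; pose proof V_T as VT.
assert (Hif : isfun (val G g)).
{ split.
  - intros v Hv; destruct (mem_val_value_name Hg Hv) as [p [b [y [_ [_ [_ [_ [-> _]]]]]]]].
    eauto.
  - intros b v v' Hv Hv'.
    destruct (mem_val_value_name Hg Hv) as [p [b1 [y [Hp [Hb [Hy [Hpg [E _]]]]]]]].
    destruct (opair_inj E); subst b1 v.
    destruct (mem_val_value_name Hg Hv') as [p' [b1 [y' [Hp' [_ [Hy' [Hpg' [E' _]]]]]]]].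
    destruct (opair_inj E'); subst b1 v'.
    destruct (gen_dir3 Hq Hp Hp') as [r0 [Hr0 [Hrq [Hrp Hrp']]]].
    destruct (@generic_dense_below (sep (cond S) (fun r => feq r y y')) r0) as [r [Hr Hf]].
    + pose proof (V_elt VT Hy); pose proof (V_elt VT Hy').
      apply V_sep; [apply V_cond|]; definability.
    + exact Hr0.
    + intros r Hr; destruct (Hsv b Hb y Hy y' Hy' p (gen_cond Hp) p' (gen_cond Hp')
        Hpg Hpg' r (proj1 (le_cond Hr)) (le_trans Hr Hrq) (le_trans Hr Hrp)
        (le_trans Hr Hrp')) as [r' [Hc [Hr' Hf]]].
      exists r'; split; [exact Hr'|]; apply mem_sep; auto.
    + apply mem_sep in Hf; exact (feq_sound Hr (proj2 Hf)). }
assert (Hdom : fdom (val G g) = a).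
{ apply zset_ext; intros b; rewrite mem_fdom; split.
  - intros [v Hv]; destruct (mem_val_value_name Hg Hv) as [p [b1 [y [_ [Hb [_ [_ [E _]]]]]]]].
    destruct (opair_inj E); now subst.
  - intros Hb; pose proof (V_elt hk (k_sub Ha Hb)) as Vb.
    destruct (@generic_dense_below (sep (cond S) (fun r => exists y, y ∈ T /\
      exists p, p ∈ cond S /\ ⟨p, entry_at b y⟩ ∈ g /\ r ≼ p)) q) as [r [Hr Hf]].
    + apply V_sep; [apply V_cond|]; definability.
    + exact Hq.
    + intros q' Hq'; destruct (Htot b Hb q' (proj1 (le_cond Hq')) Hq')
        as [r [Hr [Hrq [y [Hy [p [Hp [Hpg [Hrp _]]]]]]]]].
      exists r; split; [exact Hrq|]; apply mem_sep; split; eauto 7.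
    + apply mem_sep in Hf; destruct Hf as [_ [y [_ [p [_ [Hpg Hrp]]]]]].
      exists (val G y); rewrite <- val_entry_at; apply mem_val; exists p, (entry_at b y).
      split; [exact (generic_up hG Hr Hrp) | auto]. }
split; [exact Hif|]; split; [exact Hdom|]; intros b Hb.
assert (Hv : ⟨b, app (val G g) b⟩ ∈ val G g) by (apply app_mem; [exact Hif | now rewrite Hdom]).
destruct (mem_val_value_name Hg Hv) as [p [b1 [y [Hp [_ [_ [_ [E Hfv]]]]]]]].
destruct (opair_inj E) as [<- ->].
exact (forced_value_sound (k_sub Ha Hb) Hp Hfv).
Qed.

Lemma forced_selector_open p q a g : forced_selector p a g -> q ≼ p ->
  forced_selector q a g.
Proof.
intros [Hg [Hsv Htot]] Hq; split; [exact Hg|]; split.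
- intros b Hb y Hy y' Hy' s Hs s' Hs' Hsg Hsg' r Hr Hrq.
  apply (Hsv b Hb y Hy y' Hy' s Hs s' Hs' Hsg Hsg' r Hr (le_trans Hrq Hq)).
- intros b Hb q' Hq' Hle; exact (Htot b Hb q' Hq' (le_trans Hle Hq)).
Qed.

(** Value names are subsets of this set, so [V] has a set of all of them. *)
Definition entries : zset :=
  prod (cond S) (image (fun c => entry_at (zfst c) (zsnd c)) (prod k T)).

Lemma V_entries : V entries.
Proof.
apply V_prod; [apply V_cond|]; apply V_image; [apply V_prod; [exact hk|exact V_T]|].
definability.
Qed.
Local Hint Resolve V_entries : model.

Lemma mem_entries p b y : p ∈ cond S -> b ∈ k -> y ∈ T -> ⟨p, entry_at b y⟩ ∈ entries.
Proof.
intros Hp Hb Hy; apply mem_prod_pair; split; [exact Hp|]; apply mem_image.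
exists ⟨b, y⟩; rewrite mem_prod_pair, zfst_pair, zsnd_pair; auto.
Qed.

Lemma value_name_entries a g : a ⊆ k -> value_name a g -> g ⊆ entries.
Proof.
intros Ha Hg x Hx; destruct (Hg x Hx) as [p [Hp [b [Hb [y [Hy [-> _]]]]]]].
apply mem_entries; auto.
Qed.

Definition value_name_of (a : zset) (Q : zset -> zset -> zset -> Prop) : zset :=
  sep entries (fun x => exists p, p ∈ cond S /\ exists b, b ∈ a /\ exists y, y ∈ T /\
    x = ⟨p, entry_at b y⟩ /\ forced_value p b y /\ Q p b (entry_at b y)).

Lemma value_name_of_value_name a Q : value_name a (value_name_of a Q).
Proof.
intros x Hx; apply mem_sep in Hx.
destruct Hx as [_ [p [Hp [b [Hb [y [Hy [E [Hv _]]]]]]]]].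
exists p; split; [exact Hp|]; exists b; split; [exact Hb|]; exists y; auto.
Qed.

Lemma mem_value_name_of a Q p b y : a ⊆ k -> p ∈ cond S -> b ∈ a ->
  forced_value p b y -> Q p b (entry_at b y) -> ⟨p, entry_at b y⟩ ∈ value_name_of a Q.
Proof.
intros Ha Hp Hb Hv HQ; pose proof (forced_value_T Hv) as Hy.
apply mem_sep; split; [apply mem_entries; auto|].
exists p; split; [exact Hp|]; exists b; split; [exact Hb|]; exists y; auto.
Qed.

(** That equal entries have equal arguments is read off from their values. *)
Lemma value_name_of_entry a Q p b y : ⟨p, entry_at b y⟩ ∈ value_name_of a Q ->
  b ∈ a /\ Q p b (entry_at b y).
Proof.
intros H; apply mem_sep in H; destruct H as [_ [p' [_ [b' [Hb [y' [_ [E [_ HQ]]]]]]]]].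
destruct (opair_inj E) as [-> E'].
assert (Eb : b = b').
{ pose proof (val_entry_at b y) as E1; rewrite E', val_entry_at in E1.
  now destruct (opair_inj E1). }
subst b'; rewrite E'; auto.
Qed.

(** The symmetries of [Fn] preserve forced values, and so only those of [Q] are in
    question. *)
Lemma value_name_of_sym a Q K : a ⊆ k -> V (value_name_of a Q) -> K ∈ filt S ->
  (forall f p b x, f ∈ K -> symmetric_name V S x -> Q p b x -> Q (app f p) b (act f x)) ->
  sym S (value_name_of a Q) ∈ filt S.
Proof.
intros Ha VQ HK HQ; apply sym_filt with (inter K (sym S Fn)).
- exact VQ.
- exact (value_name_is_name Ha (@value_name_of_value_name a Q)).
- apply hS; [exact HK | exact (sname_sym hFn)].
- intros f p x Hf Hx; apply mem_inter in Hf; destruct Hf as [Hf HfF].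
  pose proof (filt_grp HK Hf) as Hfg; apply mem_sep in Hx.
  destruct Hx as [_ [p' [Hp [b [Hb [y [Hy [E [Hv Hq]]]]]]]]].
  destruct (opair_inj E); subst p' x.
  rewrite act_entry_at by exact Hfg; apply mem_value_name_of; auto.
  + exact (aut_cond (grp_aut Hfg) Hp).
  + apply forced_value_act; auto; exact (V_elt hk (Ha b Hb)).
  + rewrite <- act_entry_at by exact Hfg; apply HQ; auto.
    apply sname_entry_at; [exact (V_elt hk (Ha b Hb)) | exact (forced_value_sname Hv)].
Qed.

(** The name collects the entries that are forced into the given name [g0].  [G] avoids
    the conditions that witness a failure of single-valuedness ([A1] in the proof) or of
    totality ([A2]), so a condition in [G] has no such extension. *)
Lemma forced_selector_complete a g0 : a ∈ k -> symmetric_name V S g0 ->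
  selects (val G g0) F a ->
  exists q g, q ∈ G /\ V g /\ sym S g ∈ filt S /\ forced_selector q a g.
Proof.
intros Ha Hg0 [H1 [H2 H3]]; pose proof V_T as VT; pose proof (sname_V Hg0) as Vg0.
pose proof (V_elt hk Ha) as Va; pose proof (k_sub Ha) as Hak.
set (g := value_name_of a (fun p _ x => fmem p x g0)).
assert (Vg : V g).
{ apply V_sep; [apply V_entries|]; definability. }
assert (Hgs : sym S g ∈ filt S).
{ apply value_name_of_sym with (sym S g0); auto; [exact (sname_sym Hg0)|].
  intros f p _ x Hf Hx Hm; apply mem_sym in Hf; destruct Hf as [Hf E].
  rewrite <- E; apply fmem_act; auto using sname_name. }
assert (Hval : forall p b y, p ∈ G -> ⟨p, entry_at b y⟩ ∈ g -> y ∈ T ->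
  val G y = app (val G g0) b).
{ intros p b y Hp Hpg Hy; destruct (value_name_of_entry Hpg) as [Hb Hm].
  symmetry; apply app_eq; [exact H1|]; rewrite <- val_entry_at; apply fmem_truth; eauto.
  apply V_entry_at; [exact (V_elt Va Hb) | exact (V_elt VT Hy)]. }
set (A1 := sep (cond S) (fun q => exists b, b ∈ a /\ exists y, y ∈ T /\ exists y', y' ∈ T /\
  exists p, p ∈ cond S /\ exists p', p' ∈ cond S /\ ⟨p, entry_at b y⟩ ∈ g /\
  ⟨p', entry_at b y'⟩ ∈ g /\ q ≼ p /\ q ≼ p' /\
  forall r, r ∈ cond S -> r ≼ q -> ~ feq r y y')).
assert (VA1 : V A1).
{ apply V_sep; [apply V_cond|]; definability. }
set (A2 := sep (cond S) (fun q => exists b, b ∈ a /\ forall r, r ∈ cond S -> r ≼ q ->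
  forall y, y ∈ T -> forall p, p ∈ cond S -> ⟨p, entry_at b y⟩ ∈ g -> r ≼ p ->
  ~ forced_value p b y)).
assert (VA2 : V A2).
{ apply V_sep; [apply V_cond|]; definability. }
destruct (generic_decides VA1) as [[q [Hq HA]] | [q1 [Hq1 HA1]]].
{ exfalso; apply mem_sep in HA.
  destruct HA as [_ [b [Hb [y [Hy [y' [Hy' [p [_ [p' [_ [Hpg [Hpg' [Hqp [Hqp' N]]]]]]]]]]]]]]].
  assert (E : val G y = val G y').
  { rewrite (Hval p b y), (Hval p' b y'); auto;
      [exact (generic_up hG Hq Hqp') | exact (generic_up hG Hq Hqp)]. }
  destruct (feq_complete (V_elt VT Hy) (V_elt VT Hy') E) as [r [Hr Hf]].
  destruct (generic_dir hG Hq Hr) as [r' [Hr' [L1 L2]]].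
  exact (N r' (gen_cond Hr') L1 (feq_open Hf L2)). }
destruct (generic_decides VA2) as [[q [Hq HA]] | [q2 [Hq2 HA2]]].
{ exfalso; apply mem_sep in HA; destruct HA as [_ [b [Hb N]]].
  destruct (forced_value_complete (Hak b Hb) (H3 b Hb)) as [r0 [y [Hr0 [E Hv]]]].
  pose proof (forced_value_T Hv) as Hy.
  assert (Hm : val G (entry_at b y) ∈ val G g0).
  { rewrite val_entry_at, <- E; apply app_mem; [exact H1 | now rewrite H2]. }
  apply fmem_truth in Hm; [|apply V_entry_at;
    [exact (V_elt Va Hb) | exact (V_elt VT Hy)] | exact Vg0].
  destruct Hm as [r1 [Hr1 Hm]]; destruct (gen_dir3 Hq Hr0 Hr1) as [p [Hp [L [L0 L1]]]].
  pose proof (forced_value_open Hv L0) as Hv'.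
  refine (N p (gen_cond Hp) L y Hy p (gen_cond Hp) _ (le_refl (gen_cond Hp)) Hv').
  apply mem_value_name_of; auto; [exact (gen_cond Hp) | exact (fmem_open Hm L1)]. }
destruct (generic_dir hG Hq1 Hq2) as [q [Hq [L1 L2]]].
exists q, g; split; [exact Hq|]; split; [exact Vg|]; split; [exact Hgs|].
split; [apply value_name_of_value_name|]; split.
- intros b Hb y Hy y' Hy' p Hp p' Hp' Hpg Hpg' r Hr Hrq Hrp Hrp'.
  apply NNPP; intros N; apply (HA1 r (le_trans Hrq L1)), mem_sep; split; [exact Hr|].
  exists b; split; [exact Hb|]; exists y; split; [exact Hy|]; exists y'; split; [exact Hy'|].
  exists p; split; [exact Hp|]; exists p'; repeat split; auto.
  intros r' Hr' Hle Hf; apply N; eauto.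
- intros b Hb q' Hq' Hle; apply NNPP; intros N.
  apply (HA2 q' (le_trans Hle L2)), mem_sep; split; [exact Hq'|]; exists b; split; [exact Hb|].
  intros r Hr Hrq y Hy p Hp Hpg Hrp Hv; apply N; exists r; split; [exact Hr|].
  split; [exact Hrq|]; exists y; split; [exact Hy|]; exists p; auto.
Qed.

(** A uniform restriction operation on names; with names of arbitrary shape a choice
    of names would be needed. *)
Definition restrict_name (b g : zset) : zset := value_name_of b (fun p _ x => ⟨p, x⟩ ∈ g).

Lemma definable_restrict_name n s t : definable_term n s -> definable_term n t ->
  definable_term n (fun e => restrict_name (s e) (t e)).
Proof.
intros Hs Ht; pose proof V_T as VT; unfold restrict_name, value_name_of; definability.
Qed.

Lemma V_restrict_name b g : V b -> V g -> V (restrict_name b g).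
Proof. intros Hb Hg; apply V_term, definable_restrict_name; definability. Qed.

Lemma restrict_name_sym b g : b ⊆ k -> V b -> V g -> sym S g ∈ filt S ->
  sym S (restrict_name b g) ∈ filt S.
Proof.
intros Hb Vb Vg Hg; apply value_name_of_sym with (sym S g); auto;
  [now apply V_restrict_name|].
intros f p _ x Hf _ Hx; apply mem_sym in Hf; destruct Hf as [_ E].
rewrite <- E; apply mem_act; eauto.
Qed.

Lemma forced_selector_restrict q a b g : a ∈ k -> b ∈ a -> forced_selector q a g ->
  forced_selector q b (restrict_name b g).
Proof.
intros Ha Hb [Hg [Hsv Htot]].
assert (Hba : b ⊆ a) by exact (proj1 (ordinal_elt k_ordinal Ha) b Hb).
split; [apply value_name_of_value_name|]; split.
- intros c Hc y Hy y' Hy' p Hp p' Hp' Hpg Hpg'.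
  exact (Hsv c (Hba c Hc) y Hy y' Hy' p Hp p' Hp'
    (proj2 (value_name_of_entry Hpg)) (proj2 (value_name_of_entry Hpg'))).
- intros c Hc q' Hq' Hle.
  destruct (Htot c (Hba c Hc) q' Hq' Hle) as [r [Hr [Hrq [y [Hy [p [Hp [Hpg [Hrp Hv]]]]]]]]].
  exists r; split; [exact Hr|]; split; [exact Hrq|]; exists y; split; [exact Hy|].
  exists p; split; [exact Hp|]; split; [|auto].
  apply mem_value_name_of; auto; intros d Hd; exact (k_sub Ha (Hba d Hd)).
Qed.

(** A condition [q] in [G] has, for every [a] in [k], a symmetric name that it forces to
    be a selector of [F ↾ a]; restriction of names makes these sets of names approachable
    in [V].  A selector [c] of them in [V] need not be symmetric, but on an unbounded
    set [I] its values have a common group of symmetries in the filter, which then also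
    fixes the name obtained by gluing. *)
Lemma EC_lift_selector : EC V k ->
  (forall b, b ∈ k -> exists f, extension V S G f /\ selects f F b) ->
  exists f, extension V S G f /\ selector f F.
Proof.
intros HEC Hsel; pose proof V_T as VT.
destruct (V_power V_entries) as [Q [VQ HQ]].
set (N := fun q a => sep Q (fun g => sym S g ∈ filt S /\ forced_selector q a g)).
assert (HN : forall q a g, a ∈ k ->
  (g ∈ N q a <-> V g /\ sym S g ∈ filt S /\ forced_selector q a g)).
{ intros q a g Ha; unfold N; rewrite mem_sep, HQ; split; [tauto|].
  intros [Vg [Hg Hf]]; split; [|auto]; split; [exact Vg|].
  exact (value_name_entries (k_sub Ha) (proj1 Hf)). }
assert (DN : forall n s t, definable_term n s -> definable_term n t ->
  definable_term n (fun e => N (s e) (t e))).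
{ intros n s t Hs Ht; unfold N; definability; apply definable_forced_selector; definability. }
(* The conditions forcing some symmetric name to be a selector of [F ↾ a]. *)
set (E := graph (fun a => sep (cond S) (fun q => N q a <> empty)) k).
assert (HE : forall a q, a ∈ k -> (q ∈ app E a <-> q ∈ cond S /\ exists g, g ∈ N q a)).
{ intros a q Ha; unfold E; rewrite (app_graph _ Ha), mem_sep.
  apply and_iff_compat_l; split; [apply nonempty_inhabited|].
  intros [g Hg] E0; rewrite E0 in Hg; exact (not_mem_empty Hg). }
destruct (@distributive_meet E) as [q [HqG Hq]].
{ apply V_graph; [exact hk|]; definability; apply DN; definability. }
{ intros a Ha p Hp; now apply HE in Hp. }
{ intros a p r Ha Hp Hr; apply HE in Hp; [|exact Ha]; apply HE; [exact Ha|].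
  split; [apply (le_cond Hr)|]; destruct Hp as [_ [g Hg]]; exists g.
  apply HN in Hg; [|exact Ha]; apply HN; [exact Ha|]; destruct Hg as [Vg [Hg Hf]].
  split; [exact Vg|]; split; [exact Hg | exact (forced_selector_open Hf Hr)]. }
{ intros b a Ha Hb p Hp; pose proof (k_sub Ha Hb) as Hbk.
  apply HE in Hp; [|exact Ha]; apply HE; [exact Hbk|].
  destruct Hp as [Hp [g Hg]]; split; [exact Hp|]; exists (restrict_name b g).
  apply HN in Hg; [|exact Ha]; apply HN; [exact Hbk|]; destruct Hg as [Vg [Hg Hf]].
  pose proof (V_elt hk Hbk) as Vb; split; [now apply V_restrict_name|].
  split; [now apply restrict_name_sym; [apply k_sub|..]|].
  exact (forced_selector_restrict Ha Hb Hf). }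
{ intros a Ha; destruct (Hsel a Ha) as [f [[g0 [Hg0 ->]] Hf]].
  destruct (forced_selector_complete Ha Hg0 Hf) as [q [g [Hq Hg]]].
  exists q; split; [exact Hq|]; apply HE; [exact Ha|]; split; [exact (gen_cond Hq)|].
  exists g; now apply HN. }
pose proof (V_elt V_cond (gen_cond HqG)) as Vq.
assert (VN : V (graph (N q) k)).
{ apply V_graph; [exact hk|]; apply DN; definability. }
destruct (HEC (graph (N q) k) VN) as [c [Vc [Hc1 [Hc2 Hc3]]]].
{ split; [apply isfun_graph|]; split; [apply fdom_graph|]; split; intros a Ha.
  - rewrite (app_graph (N q) Ha); intros E0.
    destruct (proj2 (proj1 (HE a q Ha) (Hq a Ha))) as [g Hg]; rewrite E0 in Hg.
    exact (not_mem_empty Hg).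
  - destruct (proj2 (proj1 (HE a q Ha) (Hq a Ha))) as [g Hg].
    apply HN in Hg; [|exact Ha]; destruct Hg as [Vg [Hg Hf]].
    pose proof (V_elt hk Ha) as Va.
    exists (graph (fun b => restrict_name b g) a); split.
    + apply V_graph; [exact Va|]; apply definable_restrict_name; definability.
    + apply selector_restr; [apply isfun_graph | rewrite fdom_graph; exact (k_sub Ha)|].
      split; [apply isfun_graph|]; split; [apply fdom_graph|]; intros b Hb.
      pose proof (k_sub Ha Hb) as Hbk; pose proof (V_elt hk Hbk) as Vb.
      rewrite (app_graph _ Hb), (app_graph (N q) Hbk); apply HN; [exact Hbk|].
      split; [now apply V_restrict_name|].
      split; [now apply restrict_name_sym; [apply k_sub|..]|].
      exact (forced_selector_restrict Ha Hb Hf). }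
rewrite fdom_graph in Hc2, Hc3.
assert (Hc : forall a, a ∈ k ->
  V (app c a) /\ sym S (app c a) ∈ filt S /\ forced_selector q a (app c a)).
{ intros a Ha; apply HN; [exact Ha|]; rewrite <- (app_graph (N q) Ha); auto. }
destruct (proj2 hdist (graph (fun a => sym S (app c a)) k)) as [I [VI [Hun HK]]].
{ apply V_graph; [exact hk|]; definability. }
{ split; [apply isfun_graph|]; split; [apply fdom_graph|]; intros a Ha.
  rewrite (app_graph _ Ha); now apply Hc. }
set (K := sep (grp S) (fun f => forall a, a ∈ I ->
  f ∈ app (graph (fun a => sym S (app c a)) k) a)) in HK.
set (fn := value_name_of k (fun p b x => exists d, d ∈ I /\ next_in I b d /\ ⟨p, x⟩ ∈ app c d)).
assert (Vfn : V fn).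
{ apply V_sep; [apply V_entries|]; definability. }
assert (Hfs : sym S fn ∈ filt S).
{ apply value_name_of_sym with K; [intros x; auto | exact Vfn | exact HK|].
  intros f p b x Hf _ [d [Hd [Hn Hx]]]; exists d; split; [exact Hd|]; split; [exact Hn|].
  apply mem_sep in Hf; destruct Hf as [_ Hf]; specialize (Hf d Hd).
  rewrite (app_graph _ (proj1 Hun d Hd)) in Hf; apply mem_sym in Hf.
  destruct Hf as [_ Ef]; rewrite <- Ef; apply mem_act; eauto. }
assert (Hfv : value_name k fn) by apply value_name_of_value_name.
exists (val G fn); split.
{ exists fn; split; [|reflexivity].
  apply value_name_sname with k; auto; intros x; auto. }
assert (HcI : forall d, d ∈ I -> V (app c d) /\ forced_selector q d (app c d)).
{ intros d Hd; split; apply Hc, (proj1 Hun d Hd). }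
apply selector_glue with I (fun d => val G (app c d)); auto.
- intros d Hd; destruct (HcI d Hd) as [Vd Hd'].
  exact (forced_selector_sound HqG (proj1 Hun d Hd) Vd Hd').
- intros w Hw; destruct (mem_val_value_name Hfv Hw) as [p [b [y [_ [_ [_ [_ [-> _]]]]]]]].
  eauto.
- intros b v; split.
  + intros Hw; destruct (mem_val_value_name Hfv Hw) as [p [b' [y [Hp [Hb [_ [Hx [E' _]]]]]]]].
    destruct (opair_inj E'); subst b' v.
    destruct (value_name_of_entry Hx) as [_ [d [Hd [Hn Hxd]]]].
    split; [exact Hb|]; exists d; split; [exact Hn|].
    rewrite <- val_entry_at; apply mem_val; eauto.
  + intros [Hb [d [Hn Hw]]]; destruct (HcI d (proj1 Hn)) as [_ [Hd' _]].
    destruct (mem_val_value_name Hd' Hw) as [p [b' [y [Hp [_ [_ [Hx [E' Hv]]]]]]]].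
    destruct (opair_inj E'); subst b' v; rewrite <- val_entry_at.
    apply mem_val; exists p, (entry_at b y); split; [exact Hp|]; split; [|reflexivity].
    apply mem_value_name_of; auto; [intros x; auto | exact (gen_cond Hp)|].
    exists d; split; [apply Hn | auto].
Qed.

End Lifting.

Lemma EC_extension : EC V k -> EC (extension V S G) k.
Proof.
intros HEC F [Fn [HFn ->]] [HF [HdF [_ Hsel]]].
apply EC_lift_selector; auto; intros b Hb; destruct (Hsel b Hb) as [f [Hf Hs]].
exists f; split; [exact Hf|].
apply (@selector_restr f (val G Fn) b HF); [rewrite HdF; exact (k_sub Hb) | exact Hs].
Qed.

End Model.

Theorem theorem1p12 (V : zset -> Prop) (hV : ZF_model V)
  (k : zset) (hk : V k) (hreg : regular_cardinal V k)
  (S : system) (hS : symmetric_system V S) (hdist : desc_distributive V k S)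
  (G : zset) (hG : generic V S G) :
  EC (extension V S G) k <-> EC V k.
Proof.
destruct (forcing_max (sys_forcing hS)) as [one [H1 H2]]; split.
- now apply (@EC_ground V hV S hS one H1 H2 G hG k hk hreg hdist).
- now apply (@EC_extension V hV S hS one H1 H2 G hG k hk hreg hdist).
Qed.
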